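(* Let $m,n\ge1$ and $M\in\mathbb S_{++}^{mn}$. For $G\in\mathcal K_{m,n}$ define $$R_G(M)=\log(G^{-1/2}MG^{-1/2}),\qquad V(G)=\Pi_{\mathcal L}R_G(M),\qquad f(G)=\tfrac12 d_{\mathrm{AI}}(G,M)^2.$$ Then for every $G\in\mathcal K_{m,n}$, $$V(G)=0\iff G=P_{\mathcal K}(M),$$ and $$d_{\mathrm{AI}}(G,P_{\mathcal K}(M))\le\|V(G)\|_F,\qquad 0\le f(G)-f(P_{\mathcal K}(M))\le\tfrac12\|V(G)\|_F^2.$$
   Context: $\mathbb S^d$ denotes real symmetric $d\times d$ matrices and $\mathbb S_{++}^d$ the positive-definite ones. The affine-invariant distance is $d_{\mathrm{AI}}(G_0,G_1)=\|\log(G_0^{-1/2}G_1G_0^{-1/2})\|_F$. The Kronecker family is $\mathcal K_{m,n}=\{B\otimes A: A\in\mathbb S_{++}^m,\ B\in\mathbb S_{++}^n\}\subset\mathbb S_{++}^{mn}$. For every $M\in\mathbb S_{++}^{mn}$ there is a unique point $P_{\mathcal K}(M)=\operatorname*{arg\,min}_{G\in\mathcal K_{m,n}}d_{\mathrm{AI}}(M,G)$. The log-Kronecker subspace is $\mathcal L_{m,n}=\{I_n\otimes X+Y\otimes I_m: X\in\mathbb S^m,\ Y\in\mathbb S^n\}\subset\mathbb S^{mn}$, and $\Pi_{\mathcal L}$ is the Frobenius-orthogonal projection of $\mathbb S^{mn}$ onto it. *)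

(* Defs.v *)
From mathcomp Require Import all_boot all_order all_algebra.
From mathcomp Require Import sesquilinear.
From mathcomp Require character.
From mathcomp Require Import boolp classical_sets reals exp.

Set Implicit Arguments.
Unset Strict Implicit.
Unset Printing Implicit Defensive.

Import Order.TTheory GRing.Theory Num.Theory.
Local Open Scope classical_set_scope.
Local Open Scope ring_scope.

(* [character.tprod B A] is the block matrix whose (i, j) block is
   [B i j *: A]. *)
Notation "B *t A" := (character.tprod B A)
  (at level 40, left associativity) : ring_scope.

Definition frob_dot (R : realType) (d : nat) (S T : 'M[R]_d) : R :=
  \tr (S^T *m T).

Definition frob_norm (R : realType) (d : nat) (S : 'M[R]_d) : R :=
  Num.sqrt (frob_dot S S).

Definition spd (R : realType) (d : nat) : set 'M[R]_d :=
  [set G | G \is symmetricmx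
         /\ forall v : 'cV[R]_d, v != 0 -> 0 < (v^T *m G *m v) 0 0].

(* Functional calculus on real symmetric matrices: if S = U^T diag(s) U with U
   orthogonal, then [symfun f S] = U^T diag(f(s)) U, which does not depend on
   the chosen diagonalization.  The value is 0 if S is not symmetric. *)
Definition symfun (R : realType) (d : nat) (f : R -> R) (S : 'M[R]_d) :
    'M[R]_d :=
  xget 0 [set T | exists (U : 'M[R]_d) (s : 'rV[R]_d),
    [/\ U *m U^T = 1%:M,
        S = U^T *m diag_mx s *m U &
        T = U^T *m diag_mx (map_mx f s) *m U]].

Definition logmx (R : realType) (d : nat) (S : 'M[R]_d) : 'M[R]_d :=
  symfun (@ln R) S.

Definition powmx (R : realType) (d : nat) (S : 'M[R]_d) (a : R) : 'M[R]_d :=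
  symfun (fun x => x `^ a) S.

(* R_G(M) = log(G^(-1/2) M G^(-1/2)) *)
Definition ai_log (R : realType) (d : nat) (G M : 'M[R]_d) : 'M[R]_d :=
  logmx (powmx G (- 2^-1) *m M *m powmx G (- 2^-1)).

Definition ai_dist (R : realType) (d : nat) (G0 G1 : 'M[R]_d) : R :=
  frob_norm (ai_log G0 G1).

Definition kron_family (R : realType) (m n : nat) : set 'M[R]_(n * m) :=
  [set G | exists (A : 'M[R]_m) (B : 'M[R]_n),
    [/\ spd A, spd B & G = B *t A]].

(* P_K(M): the minimizer of d_AI(M, .) over the Kronecker family; 0 is the
   value if there is none. *)
Definition kron_proj (R : realType) (m n : nat) (M : 'M[R]_(n * m)) :
    'M[R]_(n * m) :=
  xget 0 [set P | kron_family P
                /\ forall G, kron_family G -> ai_dist M P <= ai_dist M G].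

Definition log_kron (R : realType) (m n : nat) : set 'M[R]_(n * m) :=
  [set L | exists (X : 'M[R]_m) (Y : 'M[R]_n),
    [/\ X \is symmetricmx, Y \is symmetricmx &
        L = (1%:M : 'M[R]_n) *t X + Y *t (1%:M : 'M[R]_m)]].

(* The W in L with S - W orthogonal to L, which exists and is unique. *)
Definition log_kron_proj (R : realType) (m n : nat) (S : 'M[R]_(n * m)) :
    'M[R]_(n * m) :=
  xget 0 [set W | log_kron W
                /\ forall Z, log_kron Z -> frob_dot (S - W) Z = 0].

(* V(G) *)
Definition kron_residual (R : realType) (m n : nat) (M G : 'M[R]_(n * m)) :
    'M[R]_(n * m) :=
  log_kron_proj (ai_log G M).

(* f(G) *)
Definition ai_energy (R : realType) (d : nat) (M G : 'M[R]_d) : R :=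
  2^-1 * ai_dist G M ^+ 2.

(* Main.v *)
Require Import Defs.
From mathcomp Require Import all_boot all_order all_algebra.
From mathcomp Require Import boolp classical_sets reals exp.
From mathcomp Require Import sesquilinear spectral complex.
From mathcomp Require character.
From mathcomp Require Import topology normedtype sequences derive.
From mathcomp Require Import ring lra.

(** The affine-invariant metric has nonpositive curvature and the Kronecker
    family [K] is totally geodesic: seen from any [G] in [K], the logarithms of
    the points of [K] lie in the linear subspace [L].  Write [d] for the
    distance, [log_G] for the logarithm at [G], [P] for the projection of [M],
    and [V(G)] for the residual.  Nonpositive curvature enters through the law
    of cosines [ai_dist_cosine],

      [d(P, M)^2 >= d(G, P)^2 - 2 <log_G P, log_G M> + d(G, M)^2].

    Because [log_G P] is in [L], the scalar product equals [<log_G P, V(G)>], so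
    that [2 (f(G) - f(P)) <= 2 <log_G P, V(G)> - d(G, P)^2], and Cauchy-Schwarz
    bounds the right-hand side by [|V(G)|^2].  Exchanging [G] and [P] and using
    [V(P) = 0] gives [2 (f(G) - f(P)) >= d(G, P)^2]; the two estimates together
    yield [d(G, P)^2 <= <log_G P, V(G)> <= d(G, P) |V(G)|].  The first of the
    three assertions follows, as [V(G) = 0] forces [d(G, P) = 0].

    The law of cosines is the exponential metric increasing property
    [ai_dist_log], [|log P - log Q| <= d(P, Q)], transported by a congruence.
    That property comes from an exact finite inequality, [frob_norm_logB]:
    expanded in eigenbases of [P] and [Q] it is [z^2 <= 2 cosh z - 2].  Its
    right-hand side is [d(P, Q)^2] to leading order for nearby points, so
    applying it along a fine subdivision of the geodesic gives the claim.

    Two facts about the minimizer remain.  It exists ([kron_minimizer]) by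
    compactness, once the scalar ambiguity in [B t A] is normalized.  It
    satisfies [V(P) = 0] ([kron_minimizer_residual]), which follows from the law
    of cosines at nearby base points. *)

Set Implicit Arguments.
Unset Strict Implicit.
Unset Printing Implicit Defensive.
Import Order.TTheory GRing.Theory Num.Theory.
Import numFieldNormedType.Exports.
Local Open Scope ring_scope.

(** * The Frobenius inner product *)

Section Frobenius.
Context {R : realType}.

Lemma frob_dotE d (S T : 'M[R]_d) : frob_dot S T = \sum_i \sum_j S i j * T i j.
Proof.
rewrite /frob_dot /mxtrace exchange_big; apply: eq_bigr => i _.
by rewrite mxE; apply: eq_bigr => j _; rewrite mxE.
Qed.

Lemma frob_dotC d (S T : 'M[R]_d) : frob_dot S T = frob_dot T S.
Proof.
by rewrite !frob_dotE; do 2 apply: eq_bigr => ? _; rewrite mulrC.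
Qed.

Lemma frob_dotDl d (S S' T : 'M[R]_d) :
  frob_dot (S + S') T = frob_dot S T + frob_dot S' T.
Proof. by rewrite /frob_dot linearD mulmxDl linearD. Qed.

Lemma frob_dotZl d a (S T : 'M[R]_d) : frob_dot (a *: S) T = a * frob_dot S T.
Proof. by rewrite /frob_dot linearZ /= -scalemxAl linearZ. Qed.

Lemma frob_dotBl d (S S' T : 'M[R]_d) :
  frob_dot (S - S') T = frob_dot S T - frob_dot S' T.
Proof. by rewrite -scaleN1r frob_dotDl frob_dotZl mulN1r. Qed.

Lemma frob_dotDr d (S T T' : 'M[R]_d) :
  frob_dot S (T + T') = frob_dot S T + frob_dot S T'.
Proof. by rewrite frob_dotC frob_dotDl !(frob_dotC S). Qed.

Lemma frob_dotZr d a (S T : 'M[R]_d) : frob_dot S (a *: T) = a * frob_dot S T.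
Proof. by rewrite frob_dotC frob_dotZl frob_dotC. Qed.

Lemma frob_dotBr d (S T T' : 'M[R]_d) :
  frob_dot S (T - T') = frob_dot S T - frob_dot S T'.
Proof. by rewrite frob_dotC frob_dotBl !(frob_dotC S). Qed.

Lemma frob_dot_ge0 d (S : 'M[R]_d) : 0 <= frob_dot S S.
Proof.
by rewrite frob_dotE; do 2 apply: sumr_ge0 => ? _; rewrite -expr2 sqr_ge0.
Qed.

Lemma frob_dot_eq0 d (S : 'M[R]_d) : frob_dot S S = 0 -> S = 0.
Proof.
rewrite frob_dotE => /eqP; rewrite psumr_eq0 => [/allP S0|i _]; last first.
  by apply: sumr_ge0 => j _; rewrite -expr2 sqr_ge0.
apply/matrixP => i j; rewrite mxE.
have := S0 i (mem_index_enum i).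
rewrite psumr_eq0 => [/allP/(_ j (mem_index_enum j))|k _]; last first.
  by rewrite -expr2 sqr_ge0.
by rewrite /= -expr2 sqrf_eq0 => /eqP.
Qed.

Lemma frob_normE d (S : 'M[R]_d) : frob_norm S ^+ 2 = frob_dot S S.
Proof. by rewrite /frob_norm sqr_sqrtr ?frob_dot_ge0. Qed.

Lemma frob_norm_ge0 d (S : 'M[R]_d) : 0 <= frob_norm S.
Proof. exact: sqrtr_ge0. Qed.

Lemma frob_norm_eq0 d (S : 'M[R]_d) : frob_norm S = 0 -> S = 0.
Proof. by move=> S0; apply: frob_dot_eq0; rewrite -frob_normE S0 expr0n. Qed.

Lemma frob_norm0 d : frob_norm (0 : 'M[R]_d) = 0.
Proof. by rewrite /frob_norm /frob_dot mulmx0 mxtrace0 sqrtr0. Qed.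

Lemma frob_normN d (S : 'M[R]_d) : frob_norm (- S) = frob_norm S.
Proof. by rewrite /frob_norm -scaleN1r frob_dotZl frob_dotZr !mulN1r opprK. Qed.

Lemma frob_normBC d (S T : 'M[R]_d) : frob_norm (S - T) = frob_norm (T - S).
Proof. by rewrite -frob_normN opprB. Qed.

Lemma frob_CS d (S T : 'M[R]_d) : frob_dot S T <= frob_norm S * frob_norm T.
Proof.
have [T0|T0] := eqVneq (frob_norm T) 0.
  rewrite (frob_norm_eq0 T0) /frob_dot mulmx0 mxtrace0.
  by rewrite mulr_ge0 ?frob_norm_ge0.
have [S0|S0] := eqVneq (frob_norm S) 0.
  by rewrite (frob_norm_eq0 S0) /frob_dot trmx0 mul0mx mxtrace0
     mulr_ge0 ?frob_norm_ge0.
have := frob_dot_ge0 (frob_norm T *: S - frob_norm S *: T).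
rewrite !(frob_dotBl, frob_dotBr, frob_dotZl, frob_dotZr) -!frob_normE.
rewrite (frob_dotC T).
set s := frob_norm S in S0 *; set t := frob_norm T in T0 *.
have s0 : 0 < s by rewrite lt0r S0 frob_norm_ge0.
have t0 : 0 < t by rewrite lt0r T0 frob_norm_ge0.
set u := frob_dot _ _ => h.
rewrite -(ler_pM2l (mulr_gt0 s0 t0)); move: h; nra.
Qed.

Lemma frob_triangle d (S T : 'M[R]_d) :
  frob_norm (S + T) <= frob_norm S + frob_norm T.
Proof.
rewrite -(@ler_pXn2r _ 2) ?nnegrE ?addr_ge0 ?frob_norm_ge0 //.
rewrite sqrrD !frob_normE frob_dotDl !frob_dotDr (frob_dotC T S) -!frob_normE.
by have := frob_CS S T; lra.
Qed.

Lemma frob_triangleB d (S T U : 'M[R]_d) :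
  frob_norm (S - U) <= frob_norm (S - T) + frob_norm (T - U).
Proof.
have -> : S - U = (S - T) + (T - U) by rewrite addrA subrK.
exact: frob_triangle.
Qed.

Lemma frob_entry d (S : 'M[R]_d) i j : `|S i j| <= frob_norm S.
Proof.
rewrite -(@ler_pXn2r _ 2) ?nnegrE ?frob_norm_ge0 //.
rewrite frob_normE frob_dotE (bigD1 i) //= (bigD1 j) //=.
rewrite -normrX ger0_norm ?sqr_ge0 //.
rewrite -expr2 -addrA lerDl addr_ge0 //; do ?apply: sumr_ge0 => ? _.
  by rewrite -expr2 sqr_ge0.
by rewrite -expr2 sqr_ge0.
Qed.

End Frobenius.

(** * The real spectral theorem and the functional calculus *)

Section Spectral.
Context {R : realType}.

Lemma symmxP d (S : 'M[R]_d) : S \is symmetricmx <-> S^T = S.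
Proof.
split=> [/is_hermitianmxP|ST].
  by rewrite expr0 scale1r map_mx_id // => {2}->.
by apply/is_hermitianmxP; rewrite expr0 scale1r map_mx_id.
Qed.

Definition orthmx d (U : 'M[R]_d) := U *m U^T = 1%:M.

Lemma orthmxC d (U : 'M[R]_d) : orthmx U -> U^T *m U = 1%:M.
Proof. exact: mulmx1C. Qed.

Lemma orthmx_unit d (U : 'M[R]_d) : orthmx U -> U \in unitmx.
Proof. by move=> /mulmx1_unit[]. Qed.

Lemma orthmxM d (U V : 'M[R]_d) : orthmx U -> orthmx V -> orthmx (U *m V).
Proof.
by rewrite /orthmx => hU hV; rewrite trmx_mul mulmxA -(mulmxA U) hV mulmx1.
Qed.

Lemma orthmx_tr d (U : 'M[R]_d) : orthmx U -> orthmx U^T.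
Proof. by move=> /orthmxC; rewrite /orthmx trmxK. Qed.

Lemma orthmx1 d : orthmx (1%:M : 'M[R]_d).
Proof. by rewrite /orthmx trmx1 mulmx1. Qed.

(** Over [R[i]] the matrix is Hermitian, so its spectral decomposition has real
    diagonal entries; a real root of the characteristic polynomial is already
    an eigenvalue over [R]. *)
Lemma sym_eigenvalue d (S : 'M[R]_d.+1) : S^T = S ->
  exists a, eigenvalue S a.
Proof.
move=> ST; pose f : R -> R[i] := real_complex R.
pose A : 'M[R[i]]_d.+1 := map_mx f S.
have hA : A \is hermsymmx.
  apply: realsym_hermsym.
    apply/is_hermitianmxP; rewrite expr0 scale1r map_mx_id //.
    by rewrite /A map_trmx ST.
  by apply/mxOverP => i j; rewrite mxE; apply/complex_realP; exists (S i j).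
have /hermitian_normalmx/orthomx_spectralP hD := hA.
have /mxOverP/(_ 0 0)/complex_realP[a ha] := hermitian_spectral_diag_real hA.
exists a; suff : eigenvalue A (spectral_diag A 0 0).
  by rewrite ha !eigenvalue_root_char -map_char_poly fmorph_root.
apply/eigenvalueP; exists (row 0 (spectralmx A)).
  have PA : spectralmx A *m A = diag_mx (spectral_diag A) *m spectralmx A.
    by rewrite {2}hD !mulmxA mulmxV ?spectral_unit // mul1mx.
  rewrite -row_mul PA; apply/rowP => j.
  by rewrite mul_diag_mx !mxE.
apply/eqP => r0; have : delta_mx 0 0 = 0 :> 'rV[R[i]]_d.+1.
  by rewrite -(mulmxK (spectral_unit A) (delta_mx 0 0)) -rowE r0 mul0mx.
by move=> /rowP/(_ 0)/eqP; rewrite !mxE !eqxx oner_eq0.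
Qed.

Lemma row_dotE d (v : 'rV[R]_d) : (v *m v^T) 0 0 = \sum_i v 0 i ^+ 2.
Proof. by rewrite mxE; apply: eq_bigr => i _; rewrite mxE expr2. Qed.

Lemma row_dot_ge0 d (v : 'rV[R]_d) : 0 <= (v *m v^T) 0 0.
Proof. by rewrite row_dotE sumr_ge0 // => i _; exact: sqr_ge0. Qed.

Lemma row_dot_eq0 d (v : 'rV[R]_d) : (v *m v^T) 0 0 = 0 -> v = 0.
Proof.
rewrite row_dotE => /eqP.
rewrite psumr_eq0 => [/allP h|i _]; last exact: sqr_ge0.
apply/rowP => i; have := h i (mem_index_enum i).
by rewrite mxE sqrf_eq0 => /eqP.
Qed.

(** The witness is the Householder reflection that exchanges [v] with the first
    basis vector. *)
Lemma orthmx_first_row d (v : 'rV[R]_d.+1) : v *m v^T = 1%:M ->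
  exists2 U, orthmx U & delta_mx 0 0 *m U = v.
Proof.
move=> v1; pose e : 'rV[R]_d.+1 := delta_mx 0 0.
have [<-|ev] := eqVneq e v.
  by exists 1%:M; rewrite ?mulmx1 //; exact: orthmx1.
pose w := e - v.
have ee : e *m e^T = 1%:M.
  by rewrite -rowE; apply/matrixP => i j; rewrite !ord1 !mxE !eqxx.
pose a := (e *m w^T) 0 0.
have ewa : e *m w^T = a%:M by rewrite [LHS]mx11_scalar.
have ve : v *m e^T = e *m v^T.
  by apply/matrixP => i j; rewrite !ord1 !mxE; apply: eq_bigr => k _;
     rewrite !mxE mulrC.
have ww : w *m w^T = (a *+ 2)%:M.
  have -> : (a *+ 2)%:M = e *m w^T + e *m w^T by rewrite ewa mulr2n raddfD.
  by rewrite /w linearB /= mulmxBl !mulmxBr ee v1 ve opprB.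
have a0 : a != 0.
  apply: contraNneq ev => a0; rewrite -subr_eq0 -/w; apply/eqP/row_dot_eq0.
  by rewrite ww a0 mul0rn mxE mul0rn.
pose W := w^T *m w.
have WW : W *m W = (a *+ 2) *: W.
  by rewrite /W mulmxA -(mulmxA w^T) ww mul_mx_scalar -scalemxAl.
have WT : W^T = W by rewrite /W trmx_mul trmxK.
exists (1%:M - a^-1 *: W).
  rewrite /orthmx; have -> : (1%:M - a^-1 *: W)^T = 1%:M - a^-1 *: W.
    by rewrite linearB linearZ /= -/W trmx1 WT.
  rewrite mulmxBl !mulmxBr !mulmx1 mul1mx.
  rewrite -!scalemxAl -!scalemxAr WW !scalerA mulrnAr -mulrA mulVf // mulr1.
  by rewrite mulr2n scalerDl opprB addrK subrK.
rewrite /W mulmxBr mulmx1 -scalemxAr mulmxA ewa mul_scalar_mx scalerA mulVf //.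
by rewrite scale1r /w opprB addrCA subrr addr0.
Qed.

(** For orthogonal [X] this is a spectral decomposition.  For [X] invertible,
    the positive definite matrices of this form make up the flat of the frame
    [X], on which the affine-invariant geometry is Euclidean in [ln s]. *)
Definition cdiag d (X : 'M[R]_d) (s : 'rV[R]_d) := X^T *m diag_mx s *m X.

Lemma cdiagM d (X Y : 'M[R]_d) s : cdiag (X *m Y) s = Y^T *m cdiag X s *m Y.
Proof. by rewrite /cdiag trmx_mul !mulmxA. Qed.

Lemma cdiag_tr d (X : 'M[R]_d) s : (cdiag X s)^T = cdiag X s.
Proof. by rewrite /cdiag !trmx_mul trmxK tr_diag_mx mulmxA. Qed.

Lemma cdiag_block d (U : 'M[R]_d) (a : 'M[R]_1) s :
  cdiag (block_mx 1%:M 0 0 U) (row_mx a s) = block_mx a 0 0 (cdiag U s).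
Proof.
rewrite /cdiag diag_mx_row tr_block_mx !mulmx_block !trmx0 !mulmx0 !mul0mx.
rewrite trmx1 !mulmx1 !mul1mx !addr0 !add0r !mul0mx; congr block_mx.
by apply/matrixP => i j; rewrite !ord1 !mxE eqxx.
Qed.

(** Conjugation by an orthogonal matrix whose first row is an eigenvector splits
    off a one-dimensional block; the induction runs on the other block. *)
Lemma sym_spectral d (S : 'M[R]_d) : S^T = S ->
  exists U s, orthmx U /\ S = cdiag U s.
Proof.
elim: d S => [|d IH] S ST.
  by exists 1%:M, 0; split; [exact: orthmx1|rewrite [LHS]flatmx0 [RHS]flatmx0].
have [a /eigenvalueP[v va v0]] := sym_eigenvalue ST.
have vv : 0 < (v *m v^T) 0 0.
  rewrite lt0r row_dot_ge0 andbT; apply: contraNneq v0 => h.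
  exact/eqP/row_dot_eq0.
pose r := Num.sqrt ((v *m v^T) 0 0).
have r0 : r != 0 by rewrite sqrtr_eq0 -ltNge.
have [|Q Qo Qv] := @orthmx_first_row d (r^-1 *: v).
  rewrite linearZ /= -scalemxAl -scalemxAr [v *m _]mx11_scalar.
  rewrite -[(v *m _) 0 0](sqr_sqrtr (ltW vv)) -/r !scale_scalar_mx.
  by rewrite expr2 mulKf // mulVf.
have [B eB] : exists B : 'M[R]_d.+1, B = Q *m S *m Q^T.
  by exists (Q *m S *m Q^T).
have BT : B^T = B by rewrite eB !trmx_mul trmxK ST mulmxA.
have B0 : (delta_mx 0 0 : 'rV_d.+1) *m B = a *: delta_mx 0 0.
  rewrite eB !mulmxA Qv -scalemxAl va scalerA mulrC -scalerA -Qv.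
  by rewrite -scalemxAl -mulmxA Qo mulmx1.
have Bur : @ursubmx _ 1 d 1 d B = 0.
  apply/matrixP => i j; have /rowP/(_ (rshift 1 j)) := B0.
  by rewrite -rowE ord1 !mxE /= mulr0 => <-; congr (B _ _); apply/val_inj.
have Bdl : @dlsubmx _ 1 d 1 d B = 0 by rewrite -[B]BT -trmx_ursub Bur trmx0.
have [|U [s [Uo Us]]] := IH (@drsubmx _ 1 d 1 d B).
  by rewrite trmx_drsub BT.
pose V : 'M[R]_(1 + d) := block_mx 1%:M 0 0 U.
have Vo : orthmx V.
  rewrite /orthmx /V tr_block_mx mulmx_block !trmx0 !mulmx0 !mul0mx trmx1.
  rewrite mulmx1.
  by rewrite !addr0 !add0r Uo -scalar_mx_block.
exists (V *m Q), (row_mx (@ulsubmx _ 1 d 1 d B) s); split; first exact: orthmxM.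
have -> : S = Q^T *m B *m Q.
  by rewrite eB !mulmxA (orthmxC Qo) mul1mx -mulmxA (orthmxC Qo) mulmx1.
rewrite cdiagM; congr (_ *m _ *m _).
rewrite -[LHS](@submxK _ 1 d 1 d) Bur Bdl Us; exact/esym/cdiag_block.
Qed.

(** The orthogonal matrix [Z = U V^T] intertwines [diag s] and [diag t], so
    [Z i j] vanishes unless [s_i = t_j]; hence [Z] intertwines [diag (f s)] and
    [diag (f t)] as well.  This makes the functional calculus independent of the
    diagonalization. *)
Lemma cdiag_map_eq d (U V : 'M[R]_d) (s t : 'rV[R]_d) (f : R -> R) :
  orthmx U -> orthmx V -> cdiag U s = cdiag V t ->
  cdiag U (map_mx f s) = cdiag V (map_mx f t).
Proof.
move=> Uo Vo e; have [Z eZ] : exists Z, Z = U *m V^T.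
  by exists (U *m V^T).
have UE A : cdiag U A = V^T *m (Z^T *m diag_mx A *m Z) *m V.
  rewrite /cdiag eZ trmx_mul trmxK !mulmxA (orthmxC Vo) mul1mx -!mulmxA.
  by rewrite (orthmxC Vo) mulmx1.
have Zo : orthmx Z by rewrite eZ; apply: orthmxM => //; exact: orthmx_tr.
have : diag_mx s *m Z = Z *m diag_mx t.
  have := congr1 (fun A => U *m A *m V^T) e.
  rewrite /cdiag !mulmxA Uo mul1mx -!mulmxA Vo mulmx1 => h.
  by rewrite eZ h mulmxA.
move=> sZ.
suff fZ : diag_mx (map_mx f s) *m Z = Z *m diag_mx (map_mx f t).
  by rewrite UE -(mulmxA Z^T) fZ !mulmxA -(mulmxA _ Z^T) (orthmxC Zo) mulmx1.
apply/matrixP => i j; move/matrixP/(_ i j): sZ.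
rewrite !mul_diag_mx !mul_mx_diag !mxE [_ * t 0 j]mulrC [_ * f _]mulrC.
have [->|Z0] := eqVneq (Z i j) 0; first by rewrite !mulr0.
by move=> /(mulIf Z0) ->.
Qed.

Lemma symfunE d (U : 'M[R]_d) s f : orthmx U ->
  symfun f (cdiag U s) = cdiag U (map_mx f s).
Proof.
move=> Uo; rewrite /symfun.
case: xgetP => [T -> [V [t [Vo e ->]]]|/(_ (cdiag U (map_mx f s)))].
  by apply: cdiag_map_eq => //; rewrite /cdiag -e.
by case; exists U, s.
Qed.

End Spectral.

(** * Comparison of cosh with the square *)

Section Scalar.
Context {R : realType}.

(** Error factors [expR (b / 2 ^+ k)] come from cutting a segment into [2 ^ k]
    pieces; the sharp bound is the limit. *)
Lemma le_expR_dyadic (a b c : R) : 0 <= c ->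
  (forall k, a <= c * expR (b / 2 ^+ k)) -> a <= c.
Proof.
move=> c0 h; rewrite leNgt; apply/negP => ca.
have c_gt0 : 0 < c.
  rewrite lt0r c0 andbT; apply/eqP => cE; move: ca (h 0%N).
  by rewrite cE mul0r; lra.
have L0 : 0 < ln (a / c) by apply: ln_gt0; rewrite ltr_pdivlMr ?mul1r.
have a0 : 0 < a by apply: lt_trans ca.
have hL k : 2 ^+ k * ln (a / c) <= b.
  rewrite mulrC -ler_pdivlMr ?exprn_gt0 // -ler_expR lnK; last first.
    by rewrite posrE divr_gt0.
  by rewrite ler_pdivrMr // mulrC; exact: h.
have [k bk] : exists k, b / ln (a / c) < 2 ^+ k.
  exists (Num.bound `|b / ln (a / c)|); apply: le_lt_trans (ler_norm _) _.
  apply: lt_le_trans (archi_boundP (normr_ge0 _)) _.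
  by rewrite -natrX ler_nat ltnW // ltn_expl.
by have := hL k; rewrite leNgt -ltr_pdivrMr // bk.
Qed.

(** This is [(2 sinh (z / 2)) ^+ 2]. *)
Let cosh2 (z : R) := expR z + expR (- z) - 2.

Let cosh2E z : cosh2 z = expR (- z) * (expR z - 1) ^+ 2.
Proof.
rewrite /cosh2 sqrrB1 mulrDr mulrBr mulr1 mulrnAr expr2 mulrA.
by rewrite -[expR (- z) * expR z]mulrC expRxMexpNx_1; ring.
Qed.

Let cosh2N z : cosh2 (- z) = cosh2 z.
Proof. by rewrite /cosh2 opprK; ring. Qed.

Lemma expRDN_le (z : R) : expR z + expR (- z) - 2 <= z ^+ 2 * expR `|z|.
Proof.
rewrite -/(cosh2 z); wlog z0 : z / 0 <= z.
  move=> h; have [/h//|/ltW z0] := leP 0 z.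
  by rewrite -cosh2N -(opprK z) sqrrN normrN opprK; apply: h; rewrite oppr_ge0.
rewrite ger0_norm // cosh2E.
have h1 : 1 - expR (- z) <= z by have := expR_ge1Dx (- z); lra.
have e0 := expR_gt0 z; have e1 := expRxMexpNx_1 z.
have -> : expR (- z) * (expR z - 1) ^+ 2 = (1 - expR (- z)) ^+ 2 * expR z.
  move: e1; set x := expR z; set y := expR (- z) => e1.
  have -> : y * (x - 1) ^+ 2 = (x * y) * x - 2 * (x * y) + y by ring.
  have -> : (1 - y) ^+ 2 * x = x - 2 * (x * y) + (x * y) * y by ring.
  by rewrite e1; ring.
rewrite ler_pM2r // lerXn2r ?nnegrE //.
by rewrite subr_ge0 -expR0 ler_expR oppr_le0.
Qed.

(** Doubling [z] multiplies the right-hand side by at least 4 and the left-hand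
    side by exactly 4, so a bound that is only asymptotically sharp at 0
    propagates to every [z]. *)
Lemma sqr_le_expRDN (z : R) : z ^+ 2 <= expR z + expR (- z) - 2.
Proof.
rewrite -/(cosh2 z).
have double v : 4 * cosh2 v <= cosh2 (v + v).
  rewrite /cosh2 (opprD v) !expRD; have := expRxMexpNx_1 v.
  set x := expR v; set y := expR (- v) => xy.
  have -> : x * x + y * y - 2 = (x + y) ^+ 2 - 2 * (x * y) - 2 by ring.
  by rewrite xy; have := sqr_ge0 (x + y - 2); lra.
have iter k : 4 ^+ k * cosh2 (z / 2 ^+ k) <= cosh2 z.
  elim: k => [|k IH]; first by rewrite !expr0 mul1r divr1.
  apply: le_trans IH; rewrite exprSr -mulrA ler_pM2l ?exprn_gt0 //.
  apply: le_trans (double _) _; rewrite exprSr invfM mulrA -splitr.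
  exact: lexx.
have near0 v : v ^+ 2 <= cosh2 v * expR `|v|.
  wlog v0 : v / 0 <= v.
    move=> h; have [/h//|/ltW v0] := leP 0 v.
    by rewrite -cosh2N -sqrrN -normrN; apply: h; rewrite oppr_ge0.
  rewrite ger0_norm // cosh2E mulrAC [expR (- v) * _]mulrC expRxMexpNx_1 mul1r.
  have ev := expR_ge1Dx v; rewrite lerXn2r ?nnegrE //; lra.
apply: (@le_expR_dyadic _ `|z|) => [|k].
  by rewrite cosh2E mulr_ge0 ?expR_ge0 ?sqr_ge0.
have p : 0 < 2 ^+ k :> R by rewrite exprn_gt0.
have -> : z ^+ 2 = 4 ^+ k * (z / 2 ^+ k) ^+ 2.
  have -> : 4 ^+ k = (2 ^+ k) ^+ 2 :> R.
    by rewrite -exprM mulnC exprM; congr (_ ^+ _); ring.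
  by field; exact: lt0r_neq0.
apply: le_trans (ler_wpM2r (expR_ge0 _) (iter k)).
rewrite -mulrA ler_pM2l ?exprn_gt0 //.
apply: le_trans (near0 _) _.
by rewrite normrM normfV (ger0_norm (ltW p)).
Qed.
End Scalar.

(** * Frames, flats and the affine-invariant distance *)

Section Spd.
Context {R : realType}.

Definition expv d (l : 'rV[R]_d) : 'rV[R]_d := map_mx expR l.

Lemma spd_sym d (G : 'M[R]_d) : spd G -> G^T = G.
Proof. by case=> /symmxP. Qed.

Lemma cdiag_form d (X : 'M[R]_d) s (v : 'cV[R]_d) :
  (v^T *m cdiag X s *m v) 0 0 = \sum_i s 0 i * (X *m v) i 0 ^+ 2.
Proof.
have -> : v^T *m cdiag X s *m v = (X *m v)^T *m (diag_mx s *m (X *m v)).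
  by rewrite /cdiag trmx_mul !mulmxA.
rewrite mul_diag_mx mxE; apply: eq_bigr => i _; rewrite !mxE.
by rewrite expr2 mulrCA.
Qed.

Lemma spd_cdiag d (X : 'M[R]_d) (s : 'rV[R]_d) : X \in unitmx ->
  (forall i, 0 < s 0 i) -> spd (cdiag X s).
Proof.
move=> Xu s0; split; first exact/symmxP/cdiag_tr.
move=> v v0; rewrite cdiag_form lt0r; apply/andP; split; last first.
  by apply: sumr_ge0 => i _; rewrite mulr_ge0 ?sqr_ge0 // ltW.
apply: contraNneq v0 => /eqP; rewrite psumr_eq0 => [/allP h|i _]; last first.
  by rewrite mulr_ge0 ?sqr_ge0 // ltW.
have : X *m v = 0.
  apply/colP => i; have := h i (mem_index_enum i).
  by rewrite mulf_eq0 gt_eqF //= sqrf_eq0 [in RHS]mxE => /eqP.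
by move=> /(congr1 (mulmx (invmx X))); rewrite mulKmx // mulmx0 => ->.
Qed.

Lemma spd_expv d (X : 'M[R]_d) l : X \in unitmx -> spd (cdiag X (expv l)).
Proof. by move=> Xu; apply: spd_cdiag => // i; rewrite mxE expR_gt0. Qed.

Lemma spdP d (G : 'M[R]_d) : spd G ->
  exists U l, orthmx U /\ G = cdiag U (expv l).
Proof.
move=> Gp; have [U [s [Uo Gs]]] := sym_spectral (spd_sym Gp).
have s0 i : 0 < s 0 i.
  have := Gp.2 (U^T *m delta_mx i 0); rewrite Gs cdiag_form mulmxA Uo mul1mx.
  rewrite (bigD1 i) //= big1 => [|j /negPf ji]; last first.
    by rewrite mxE ji expr0n mulr0.
  rewrite mxE !eqxx expr1n mulr1 addr0; apply.
  apply/eqP => /(congr1 (mulmx U)); rewrite mulmxA Uo mul1mx mulmx0.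
  by move=> /colP/(_ i)/eqP; rewrite !mxE !eqxx oner_eq0.
exists U, (map_mx (@ln R) s); split=> //; rewrite Gs; congr cdiag.
by apply/rowP => i; rewrite !mxE lnK // posrE.
Qed.

Lemma cdiagD d (X : 'M[R]_d) s t : cdiag X (s + t) = cdiag X s + cdiag X t.
Proof. by rewrite /cdiag linearD /= mulmxDr mulmxDl. Qed.

Lemma cdiagZ d (X : 'M[R]_d) a s : cdiag X (a *: s) = a *: cdiag X s.
Proof. by rewrite /cdiag linearZ /= -scalemxAr -scalemxAl. Qed.

Lemma diag_mxM d (s t : 'rV[R]_d) :
  diag_mx s *m diag_mx t = diag_mx (\row_i (s 0 i * t 0 i)).
Proof.
apply/matrixP => i j; rewrite mul_diag_mx !mxE.
by case: eqP => [->|]; rewrite ?mulr1n ?mulr0n ?mulr0.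
Qed.

Lemma cdiag_mul d (U : 'M[R]_d) s t : orthmx U ->
  cdiag U s *m cdiag U t = cdiag U (\row_i (s 0 i * t 0 i)).
Proof.
move=> Uo; rewrite /cdiag -diag_mxM !mulmxA.
by rewrite -(mulmxA _ U) Uo mulmx1.
Qed.

Lemma expvD d (s t : 'rV[R]_d) :
  (\row_i (expv s 0 i * expv t 0 i)) = expv (s + t).
Proof. by apply/rowP => i; rewrite !mxE expRD. Qed.

Lemma expv0 d : expv (0 : 'rV[R]_d) = const_mx 1.
Proof. by apply/rowP => i; rewrite !mxE expR0. Qed.

Lemma cdiag_expv0 d (X : 'M[R]_d) : cdiag X (expv 0) = X^T *m X.
Proof. by rewrite /cdiag expv0 diag_const_mx mulmx1. Qed.

Lemma cdiag_expvD d (U : 'M[R]_d) s t : orthmx U ->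
  cdiag U (expv s) *m cdiag U (expv t) = cdiag U (expv (s + t)).
Proof. by move=> Uo; rewrite cdiag_mul // expvD. Qed.

Lemma cdiag_expvN d (U : 'M[R]_d) s : orthmx U ->
  cdiag U (expv s) *m cdiag U (expv (- s)) = 1%:M.
Proof. by move=> Uo; rewrite cdiag_expvD // subrr cdiag_expv0 orthmxC. Qed.

Lemma logmx_cdiag d (U : 'M[R]_d) l : orthmx U ->
  logmx (cdiag U (expv l)) = cdiag U l.
Proof.
move=> Uo; rewrite /logmx symfunE //; congr cdiag.
by apply/rowP => i; rewrite !mxE expRK.
Qed.

Lemma powmx_cdiag d (U : 'M[R]_d) l a : orthmx U ->
  powmx (cdiag U (expv l)) a = cdiag U (expv (a *: l)).
Proof.
move=> Uo; rewrite /powmx symfunE //; congr cdiag.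
by apply/rowP => i; rewrite !mxE -expRM mulrC.
Qed.

Lemma spd_unit d (G : 'M[R]_d) : spd G -> G \in unitmx.
Proof.
by move=> /spdP[U [l [Uo ->]]]; have /mulmx1_unit[] := cdiag_expvN l Uo.
Qed.

Lemma spd_congr d (X G : 'M[R]_d) : X \in unitmx -> spd G ->
  spd (X^T *m G *m X).
Proof.
move=> Xu /spdP[U [l [Uo ->]]]; rewrite -cdiagM.
by apply: spd_expv; rewrite unitmx_mul Xu orthmx_unit.
Qed.

Lemma spd_gram d (X : 'M[R]_d) : X \in unitmx -> spd (X^T *m X).
Proof. by move=> Xu; rewrite -cdiag_expv0; exact: spd_expv. Qed.

Lemma spd1 d : spd (1%:M : 'M[R]_d).
Proof. by have := spd_gram (unitmx1 R d); rewrite trmx1 mulmx1. Qed.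

Lemma isqrt_spd d (G : 'M[R]_d) : spd G -> spd (powmx G (- 2^-1)).
Proof.
move=> /spdP[U [l [Uo ->]]]; rewrite powmx_cdiag //.
exact/spd_expv/orthmx_unit.
Qed.

Lemma isqrtK d (G : 'M[R]_d) : spd G ->
  powmx G (- 2^-1) *m G *m powmx G (- 2^-1) = 1%:M.
Proof.
move=> /spdP[U [l [Uo ->]]]; rewrite powmx_cdiag // !cdiag_expvD //.
rewrite -[X in _ + X + _]scale1r -!scalerDl.
have -> : - 2^-1 + 1 - 2^-1 = 0 :> R by field.
by rewrite scale0r cdiag_expv0 orthmxC.
Qed.

(** Recognizes an inverse square root by its defining equation, which for a
    Kronecker product is checked factor by factor. *)
Lemma isqrt_uniq d (G Y : 'M[R]_d) : spd Y -> Y *m G *m Y = 1%:M ->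
  powmx G (- 2^-1) = Y.
Proof.
move=> /spdP[U [l [Uo ->]]] YGY.
have -> : G = cdiag U (expv (- l - l)).
  have e := cdiag_expvN l Uo; have e' := mulmx1C e.
  rewrite -cdiag_expvD // -[LHS]mul1mx -[LHS]mulmx1 -{1}e' -e.
  rewrite -[X in X *m _ = _]mulmxA mulmxA -(mulmxA (cdiag _ (expv (- l)))).
  by rewrite [X in _ *m X *m _ = _]YGY mulmx1.
rewrite powmx_cdiag //; congr (cdiag _ (expv _)).
apply/rowP => i; rewrite !mxE; by field.
Qed.

Lemma isqrt_sqrE d (G : 'M[R]_d) (Y := invmx (powmx G (- 2^-1))) : spd G ->
  Y *m Y = G.
Proof.
move=> Gp; have := isqrtK Gp; have u := spd_unit (isqrt_spd Gp).
move=> /(congr1 (fun A => Y *m A *m Y)); rewrite mulmx1 => <-.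
by rewrite !mulmxA mulVmx // mul1mx mulmxK.
Qed.

(** Diagonalize [P^(-1/2) Q P^(-1/2)] and undo the congruence. *)
Lemma spd_pencil d (P Q : 'M[R]_d) : spd P -> spd Q ->
  exists X l, [/\ X \in unitmx, P = X^T *m X & Q = cdiag X (expv l)].
Proof.
move=> Pp Qp; set Y := powmx P (- 2^-1).
have Yp : spd Y := isqrt_spd Pp; have Yu := spd_unit Yp; have YT := spd_sym Yp.
have := spd_congr Yu Qp; rewrite YT => /spdP[U [l [Uo e]]].
exists (U *m invmx Y), l; split.
- by rewrite unitmx_mul orthmx_unit // unitmx_inv.
- rewrite trmx_mul mulmxA -(mulmxA _ U^T) orthmxC // mulmx1 trmx_inv YT.
  by rewrite isqrt_sqrE.
- rewrite cdiagM -e trmx_inv YT !mulmxA mulVmx // mul1mx mulmxK //.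
Qed.

(** Since [X P^(-1/2)] is orthogonal for [P = X^T X], every frame [X] of [P]
    computes the logarithm at [P] up to rotation.  Symmetry and congruence
    invariance of the distance only amount to changes of frame. *)
Lemma ai_log_pencil d (X : 'M[R]_d) l : X \in unitmx ->
  exists2 W, orthmx W & ai_log (X^T *m X) (cdiag X (expv l)) = cdiag W l.
Proof.
move=> Xu; have Pp := spd_gram Xu.
set P := X^T *m X in Pp *; rewrite /ai_log; set Y := powmx P (- 2^-1).
have YT : Y^T = Y by apply/spd_sym/isqrt_spd.
have Wo : orthmx (X *m Y).
  apply/mulmx1C; rewrite trmx_mul YT mulmxA -(mulmxA Y); exact: isqrtK.
exists (X *m Y) => //; rewrite -[RHS]logmx_cdiag //.
by rewrite [in RHS]cdiagM YT.
Qed.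

Lemma mxtrace_diag_sum d (s : 'rV[R]_d) : \tr (diag_mx s) = \sum_i s 0 i.
Proof. by apply: eq_bigr => i _; rewrite mxE eqxx. Qed.

Lemma tr_cdiag d (U : 'M[R]_d) s : orthmx U -> \tr (cdiag U s) = \sum_i s 0 i.
Proof.
by move=> Uo; rewrite /cdiag mxtrace_mulC mulmxA Uo mul1mx mxtrace_diag_sum.
Qed.

Lemma frob_norm_cdiag d (U : 'M[R]_d) l : orthmx U ->
  frob_norm (cdiag U l) ^+ 2 = \sum_i l 0 i ^+ 2.
Proof.
move=> Uo; rewrite frob_normE /frob_dot cdiag_tr cdiag_mul // tr_cdiag //.
by apply: eq_bigr => i _; rewrite mxE expr2.
Qed.

Lemma ai_dist_ge0 d (P Q : 'M[R]_d) : 0 <= ai_dist P Q.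
Proof. exact: frob_norm_ge0. Qed.

Lemma ai_dist_pencil d (X : 'M[R]_d) l : X \in unitmx ->
  ai_dist (X^T *m X) (cdiag X (expv l)) ^+ 2 = \sum_i l 0 i ^+ 2.
Proof.
move=> Xu; rewrite /ai_dist; have [W Wo ->] := ai_log_pencil l Xu.
exact: frob_norm_cdiag.
Qed.

Lemma ai_dist_congr d (Y P Q : 'M[R]_d) : Y \in unitmx -> spd P -> spd Q ->
  ai_dist (Y^T *m P *m Y) (Y^T *m Q *m Y) = ai_dist P Q.
Proof.
move=> Yu Pp Qp; have [X [l [Xu -> ->]]] := spd_pencil Pp Qp.
have XYu : X *m Y \in unitmx by rewrite unitmx_mul Xu.
have -> : Y^T *m (X^T *m X) *m Y = (X *m Y)^T *m (X *m Y).
  by rewrite trmx_mul !mulmxA.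
rewrite -cdiagM; apply/eqP.
rewrite -(@eqrXn2 _ 2 _ _ isT (ai_dist_ge0 _ _) (ai_dist_ge0 _ _)).
by rewrite (ai_dist_pencil l XYu) (ai_dist_pencil l Xu).
Qed.

(** Moves the base point of the frame [X] along its own flat. *)
Lemma cdiag_scale d (X : 'M[R]_d) (l h : 'rV[R]_d) :
  cdiag (diag_mx (expv (2^-1 *: l)) *m X) (expv h) = cdiag X (expv (l + h)).
Proof.
rewrite cdiagM /cdiag; congr (_ *m _ *m _).
rewrite tr_diag_mx !diag_mxM; congr diag_mx.
apply/rowP => i; rewrite !mxE -!expRD; congr expR; by field.
Qed.

Lemma diag_expv_unit d (l : 'rV[R]_d) : diag_mx (expv l) \in unitmx.
Proof.
rewrite unitmxE det_diag unitfE; apply/prodf_neq0 => i _.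
by rewrite mxE expR_eq0.
Qed.

Lemma ai_dist_flat d (X : 'M[R]_d) l h : X \in unitmx ->
  ai_dist (cdiag X (expv l)) (cdiag X (expv h)) ^+ 2 =
  \sum_i (h 0 i - l 0 i) ^+ 2.
Proof.
move=> Xu; pose Z := diag_mx (expv (2^-1 *: l)) *m X.
have Zu : Z \in unitmx by rewrite unitmx_mul diag_expv_unit.
have -> : cdiag X (expv h) = cdiag Z (expv (h - l)).
  by rewrite /Z cdiag_scale addrC subrK.
have -> : cdiag X (expv l) = Z^T *m Z.
  by rewrite -cdiag_expv0 /Z cdiag_scale addr0.
by rewrite (ai_dist_pencil _ Zu); apply: eq_bigr => i _; rewrite !mxE.
Qed.

Lemma ai_distC d (P Q : 'M[R]_d) : spd P -> spd Q -> ai_dist P Q = ai_dist Q P.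
Proof.
move=> Pp Qp; have [X [l [Xu PE QE]]] := spd_pencil Pp Qp.
have {}PE : P = cdiag X (expv 0) by rewrite cdiag_expv0.
apply/eqP; rewrite -(@eqrXn2 _ 2 _ _ isT (ai_dist_ge0 _ _) (ai_dist_ge0 _ _)).
have := ai_dist_flat l 0 Xu; have := ai_dist_flat 0 l Xu.
rewrite -PE -QE => -> ->.
by apply/eqP/eq_bigr => i _; rewrite -sqrrN opprB.
Qed.

Lemma ai_dist_eq0 d (P Q : 'M[R]_d) :
  spd P -> spd Q -> ai_dist P Q = 0 -> P = Q.
Proof.
move=> Pp Qp; have [X [l [Xu PE QE]]] := spd_pencil Pp Qp => PQ.
have := ai_dist_pencil l Xu; rewrite -PE -QE PQ expr0n /= => /esym/eqP.
rewrite psumr_eq0 => [/allP l0|i _]; last exact: sqr_ge0.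
rewrite PE QE; have -> : l = 0; last by rewrite cdiag_expv0.
apply/rowP => i; have := l0 i (mem_index_enum i).
by rewrite sqrf_eq0 mxE => /eqP.
Qed.

End Spd.

(** * The exponential metric increasing property *)

Section EMI.
Context {R : realType}.

Lemma mxtrace_cdiagM d (U V : 'M[R]_d) a b :
  \tr (cdiag U a *m cdiag V b) =
  \sum_i \sum_j a 0 i * b 0 j * ((U *m V^T) i j) ^+ 2.
Proof.
have -> : \tr (cdiag U a *m cdiag V b) =
    frob_dot (U *m V^T) (diag_mx a *m (U *m V^T) *m diag_mx b).
  rewrite /frob_dot /cdiag mxtrace_mulC trmx_mul trmxK !mulmxA.
  rewrite -!(mulmxA (V^T *m diag_mx b)) mxtrace_mulC !mulmxA.
  by rewrite mxtrace_mulC !mulmxA mxtrace_mulC !mulmxA.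
rewrite frob_dotE; apply: eq_bigr => i _; apply: eq_bigr => j _.
by rewrite mul_diag_mx mul_mx_diag; set Z := U *m V^T; rewrite !mxE; ring.
Qed.

Lemma frob_norm_cdiagB d (U V : 'M[R]_d) s t : orthmx U -> orthmx V ->
  frob_norm (cdiag U s - cdiag V t) ^+ 2 =
  \sum_i \sum_j (s 0 i - t 0 j) ^+ 2 * ((U *m V^T) i j) ^+ 2.
Proof.
move=> Uo Vo; rewrite frob_normE !(frob_dotBl, frob_dotBr).
rewrite /frob_dot !cdiag_tr !cdiag_mul //.
have one (W : 'M[R]_d) : orthmx W -> cdiag W (const_mx 1) = 1%:M.
  by move=> Wo; rewrite -expv0 cdiag_expv0 orthmxC.
rewrite -[cdiag U _ in X in X - _ - _]mulmx1 -[X in _ - (_ - \tr X)]mul1mx.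
rewrite -{1}(one V) // -(one U) // [\tr (cdiag V t *m _)]mxtrace_mulC.
rewrite !mxtrace_cdiagM -!sumrB; apply: eq_bigr => i _.
by rewrite -!sumrB; apply: eq_bigr => j _; rewrite !mxE; ring.
Qed.

Lemma invmx_cdiag d (X : 'M[R]_d) l : X \in unitmx ->
  invmx (cdiag X (expv l)) = cdiag (invmx X)^T (expv (- l)).
Proof.
move=> Xu; have Cu := spd_unit (spd_expv l Xu).
rewrite -[RHS](mulKmx Cu) -[LHS]mulmx1; congr (_ *m _).
rewrite /cdiag trmxK !mulmxA mulmxK // -(mulmxA X^T) diag_mxM expvD.
rewrite subrr expv0 diag_const_mx mulmx1 -trmx_mul mulVmx //.
by rewrite trmx1.
Qed.

Lemma mxtrace_pencil d (X : 'M[R]_d) l h : X \in unitmx ->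
  \tr (invmx (cdiag X (expv l)) *m cdiag X (expv h)) =
  \sum_i expR (h 0 i - l 0 i).
Proof.
move=> Xu; rewrite invmx_cdiag // /cdiag trmxK !mulmxA mxtrace_mulC !mulmxA.
rewrite mulmxV // mul1mx -(mulmxA (diag_mx _)) -trmx_mul mulmxV // trmx1 mulmx1.
rewrite diag_mxM expvD mxtrace_diag_sum; apply: eq_bigr => i _.
by rewrite !mxE addrC.
Qed.

(** Write [P = U^T e^x U], [Q = V^T e^y V] and [Z = U V^T].  Both sides are sums
    over [(i, j)] with weights [Z i j ^+ 2]: of [(x_i - y_j)^2] on the left and
    of [2 cosh (x_i - y_j) - 2] on the right, so the inequality holds term by
    term. *)
Lemma frob_norm_logB d (P Q : 'M[R]_d) : spd P -> spd Q ->
  frob_norm (logmx P - logmx Q) ^+ 2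
    <= \tr (invmx P *m Q) + \tr (invmx Q *m P) - 2 * d%:R.
Proof.
move=> /spdP[U [x [Uo ->]]] /spdP[V [y [Vo ->]]].
have one (W : 'M[R]_d) : orthmx W -> cdiag W (const_mx 1) = 1%:M.
  by move=> Wo; rewrite -expv0 cdiag_expv0 orthmxC.
rewrite !logmx_cdiag // frob_norm_cdiagB // !invmx_cdiag ?orthmx_unit //.
have inv (W : 'M[R]_d) : orthmx W -> (invmx W)^T = W.
  move=> Wo; rewrite -[W in RHS]trmxK; congr trmx.
  by rewrite -[RHS](mulKmx (orthmx_unit Wo)) Wo mulmx1.
rewrite !inv // -[d%:R](mxtrace1 R) -(mulmx1 1%:M) -{1}(one U) // -(one V) //.
rewrite [\tr (cdiag V _ *m _)]mxtrace_mulC !mxtrace_cdiagM -big_split mulr_sumr.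
rewrite -sumrB; apply: ler_sum => i _; rewrite -big_split mulr_sumr -sumrB.
apply: ler_sum => j _; set z := (U *m V^T) i j.
rewrite !mxE /= -!expRD mulr1 mul1r.
rewrite -mulrDl -mulrBl ler_wpM2r ?sqr_ge0 //.
apply: le_trans (sqr_le_expRDN _) _.
by rewrite opprB [- x 0 i + _]addrC [expR (y 0 j - _) + _]addrC.
Qed.

Lemma frob_norm_log_flat d (X : 'M[R]_d) l h : X \in unitmx ->
  frob_norm (logmx (cdiag X (expv l)) - logmx (cdiag X (expv h))) ^+ 2
    <= \sum_i (expR (h 0 i - l 0 i) + expR (- (h 0 i - l 0 i)) - 2).
Proof.
move=> Xu; apply: le_trans (frob_norm_logB (spd_expv l Xu) (spd_expv h Xu)) _.
rewrite !mxtrace_pencil // sumrB big_split /= sumr_const card_ord mulr_natr.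
rewrite lerD2r lerD2l; apply: ler_sum => i _.
by rewrite opprB.
Qed.

(** The exponential metric increasing property, i.e. the nonpositive curvature
    of the cone.  On a piece of the geodesic from [P] to [Q] of length [h],
    [frob_norm_log_flat] bounds the displacement of the logarithm by
    [h * (1 + o(1))]; cutting the geodesic into [2 ^ k] equal pieces and letting
    [k] grow removes the error factor. *)
Theorem ai_dist_log d (P Q : 'M[R]_d) : spd P -> spd Q ->
  frob_norm (logmx P - logmx Q) <= ai_dist P Q.
Proof.
move=> Pp Qp; have [X [l [Xu PE QE]]] := spd_pencil Pp Qp.
have := ai_dist_ge0 P Q; set D := ai_dist P Q => D0.
have D2 : D ^+ 2 = \sum_i l 0 i ^+ 2 by rewrite /D PE QE ai_dist_pencil.
pose L (t : R) := logmx (cdiag X (expv (t *: l))).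
have -> : logmx P = L 0 by rewrite /L scale0r cdiag_expv0 PE.
have -> : logmx Q = L 1 by rewrite /L scale1r QE.
have lD i : `|l 0 i| <= D.
  rewrite -(@ler_pXn2r _ 2) ?nnegrE // D2 -normrX ger0_norm ?sqr_ge0 //.
  by rewrite (bigD1 i) //= lerDl sumr_ge0 // => j _; exact: sqr_ge0.
have step s t : s <= t ->
    frob_norm (L s - L t) <= (t - s) * D * expR (D * (t - s) / 2).
  move=> st; have ts : 0 <= t - s by rewrite subr_ge0.
  rewrite -(@ler_pXn2r _ 2) ?nnegrE ?frob_norm_ge0 ?mulr_ge0 ?expR_ge0 //.
  apply: le_trans (frob_norm_log_flat _ _ Xu) _.
  have -> : ((t - s) * D * expR (D * (t - s) / 2)) ^+ 2 =
      \sum_i ((t - s) * l 0 i) ^+ 2 * expR (D * (t - s)).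
    rewrite -mulr_suml exprMn [(_ * D) ^+ 2]exprMn D2 mulr_sumr -expRM_natl.
    by congr (_ * expR _); [apply: eq_bigr => i _; rewrite exprMn|field].
  apply: ler_sum => i _; rewrite !mxE -mulrBl.
  apply: le_trans (expRDN_le _) _; rewrite ler_wpM2l ?sqr_ge0 // ler_expR.
  by rewrite normrM (ger0_norm ts) mulrC ler_wpM2r.
apply: (@le_expR_dyadic _ _ (D / 2)) => // k.
set N := (2 ^ k)%N; have N0 : (0 < N)%N by rewrite expn_gt0.
have Nr : N%:R != 0 :> R by rewrite pnatr_eq0 -lt0n.
have chain n : frob_norm (L 0 - L (n%:R / N%:R)) <=
    n%:R * (N%:R^-1 * D * expR (D / 2 / N%:R)).
  elim: n => [|n IH]; first by rewrite !mul0r subrr frob_norm0.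
  apply: le_trans (frob_triangleB _ (L (n%:R / N%:R)) _) _.
  rewrite -natr1 [X in _ <= X]mulrDl mul1r lerD //.
  have := step (n%:R / N%:R) ((n%:R + 1) / N%:R).
  have -> : (n%:R + 1) / N%:R - n%:R / N%:R = N%:R^-1 :> R by field.
  rewrite [D / 2 / _]mulrAC; apply.
  by rewrite ler_wpM2r ?invr_ge0 // lerDl ler01.
have := chain N; rewrite mulfV // !mulrA mulfV // mul1r.
by rewrite /N natrX.
Qed.

End EMI.

(** * Geometric comparison inequalities *)

Section Compare.
Context {R : realType}.

Lemma isqrt_congr d (G P : 'M[R]_d) : spd G -> spd P ->
  spd (powmx G (- 2^-1) *m P *m powmx G (- 2^-1)).
Proof.
move=> Gp Pp; have Yp := isqrt_spd Gp.
by have := spd_congr (spd_unit Yp) Pp; rewrite (spd_sym Yp).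
Qed.

Lemma ai_dist_isqrt d (G P Q : 'M[R]_d) (Y := powmx G (- 2^-1)) :
  spd G -> spd P -> spd Q ->
  ai_dist (Y *m P *m Y) (Y *m Q *m Y) = ai_dist P Q.
Proof.
move=> Gp Pp Qp; have Yp := isqrt_spd Gp.
by have := ai_dist_congr (spd_unit Yp) Pp Qp; rewrite (spd_sym Yp).
Qed.

Lemma ai_log_lip d (G P Q : 'M[R]_d) : spd G -> spd P -> spd Q ->
  frob_norm (ai_log G P - ai_log G Q) <= ai_dist P Q.
Proof.
move=> Gp Pp Qp; rewrite -(ai_dist_isqrt Gp Pp Qp).
by apply: ai_dist_log; exact: isqrt_congr.
Qed.

(** The comparison with the Euclidean law of cosines at the vertex [G]: the
    logarithm at [G] shortens distances, and preserves those from [G]. *)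
Lemma ai_dist_cosine d (G P Q : 'M[R]_d) : spd G -> spd P -> spd Q ->
  ai_dist G P ^+ 2 - 2 * frob_dot (ai_log G P) (ai_log G Q) + ai_dist G Q ^+ 2
    <= ai_dist P Q ^+ 2.
Proof.
move=> Gp Pp Qp; have := ai_log_lip Gp Pp Qp.
rewrite -(@ler_pXn2r _ 2) ?nnegrE ?frob_norm_ge0 ?ai_dist_ge0 //.
rewrite frob_normE !(frob_dotBl, frob_dotBr) -!frob_normE.
by rewrite (frob_dotC (ai_log G Q)) /ai_dist; lra.
Qed.

Lemma ai_dist_triangle d (G P Q : 'M[R]_d) : spd G -> spd P -> spd Q ->
  ai_dist P Q <= ai_dist P G + ai_dist G Q.
Proof.
move=> Gp Pp Qp; rewrite {1}/ai_dist.
have -> : ai_log P Q = ai_log P G + (ai_log P Q - ai_log P G).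
  by rewrite addrC subrK.
apply: le_trans (frob_triangle _ _) _; rewrite lerD2l frob_normBC.
exact: ai_log_lip.
Qed.

Lemma ler_norm_expR (l : R) :
  `|expR l - 1| <= 2^-1 -> `|l| <= 2 * `|expR l - 1|.
Proof.
have e1 := expR_ge1Dx l; have [l0|l0] := leP 0 l.
  by rewrite (ger0_norm l0) ger0_norm; lra.
have e2 := expR_ge1Dx (- l); have e3 := expRxMexpNx_1 l; have e4 := expR_gt0 l.
rewrite (ltr0_norm l0) ler0_norm; last first.
  by rewrite subr_le0 -expR0 ler_expR ltW.
move: e3; set x := expR l in e1 e4 *; set y := expR (- l) in e2 * => e3 h.
have := ler_wpM2l (ltW e4) e2; rewrite e3.
by nra.
Qed.

(** The eigenvalues [e^l] of [Y Q Y] are at distance at most 1/2 from 1, where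
    [|l|] is bounded by twice [|e^l - 1|].  This is how entrywise continuity
    yields convergence for the affine-invariant distance. *)
Lemma ai_dist_near d (P Q : 'M[R]_d) (Y := powmx P (- 2^-1)) :
  spd P -> spd Q -> frob_norm (Y *m Q *m Y - 1%:M) <= 2^-1 ->
  ai_dist P Q <= 2 * frob_norm (Y *m Q *m Y - 1%:M).
Proof.
move=> Pp Qp; rewrite /ai_dist /ai_log -/Y.
have /spdP[U [l [Uo ->]]] : spd (Y *m Q *m Y) by exact: isqrt_congr.
rewrite logmx_cdiag //.
have -> : cdiag U (expv l) - 1%:M = cdiag U (expv l - const_mx 1).
  by rewrite -(scaleN1r (const_mx 1)) cdiagD cdiagZ -expv0 cdiag_expv0
     (orthmxC Uo) scaleN1r.
have := frob_norm_cdiag (expv l - const_mx 1) Uo.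
set e := frob_norm (cdiag U (_ - _)) => e2 eh.
have e0 : 0 <= e by exact: frob_norm_ge0.
rewrite -(@ler_pXn2r _ 2) ?nnegrE ?frob_norm_ge0 ?mulr_ge0 //.
rewrite frob_norm_cdiag // exprMn e2 mulr_sumr; apply: ler_sum => i _.
rewrite -exprMn -[l 0 i ^+ 2]ger0_norm ?sqr_ge0 // normrX.
rewrite -[leRHS]ger0_norm ?sqr_ge0 // normrX lerXn2r ?nnegrE //.
rewrite normrM (@ger0_norm _ 2) // !mxE; apply: ler_norm_expR.
apply: le_trans eh; rewrite -(@ler_pXn2r _ 2) ?nnegrE // e2.
rewrite (bigD1 i) //= !mxE -normrX ger0_norm ?sqr_ge0 // lerDl.
by rewrite sumr_ge0 // => j _; exact: sqr_ge0.
Qed.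

End Compare.

(** * Kronecker products *)

Section Kron.
Context {R : realType}.

Lemma kron_row_subproof n m (k : 'I_(n * m)) : (k %/ m < n)%N.
Proof.
have m0 : (0 < m)%N by case: m k => // k; case: k => k; rewrite muln0.
by rewrite ltn_divLR.
Qed.

Lemma kron_col_subproof n m (k : 'I_(n * m)) : (k %% m < m)%N.
Proof.
have m0 : (0 < m)%N by case: m k => // k; case: k => k; rewrite muln0.
by rewrite ltn_mod.
Qed.

(** Position [k] of a Kronecker product corresponds to position [k / m] of the
    left factor and [k mod m] of the right one. *)
Definition kron_row n m (k : 'I_(n * m)) : 'I_n :=
  Ordinal (kron_row_subproof k).

Definition kron_col n m (k : 'I_(n * m)) : 'I_m :=
  Ordinal (kron_col_subproof k).

Lemma kron_idx_inj n m (k l : 'I_(n * m)) :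
  kron_row k = kron_row l -> kron_col k = kron_col l -> k = l.
Proof.
move=> /(congr1 val) /= hr /(congr1 val) /= hc; apply/val_inj => /=.
by rewrite (divn_eq k m) (divn_eq l m) hr hc.
Qed.

Lemma kron_idx_surj n m (i : 'I_n) (j : 'I_m) :
  exists2 k, kron_row k = i & kron_col k = j.
Proof.
have h : (i * m + j < n * m)%N.
  apply: (@leq_trans (i.+1 * m)); first by rewrite mulSn addnC ltn_add2r.
  by rewrite leq_mul2r ltn_ord orbT.
have m0 : (0 < m)%N by apply: leq_ltn_trans (ltn_ord j).
exists (Ordinal h); apply/val_inj => /=.
  by rewrite divnMDl // divn_small ?addn0.
by rewrite modnMDl modn_small.
Qed.

Lemma trow_entry n m (A : 'rV[R]_n) (B : 'M[R]_m) i k :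
  character.trow A B i k = A 0 (kron_row k) * B i (kron_col k).
Proof.
elim: n A k => [|n IH] A k; first by case: k.
rewrite /= mxE; case: splitP => j /= kj.
  rewrite !mxE; congr (A _ _ * B _ _); apply/val_inj => /=.
    by rewrite kj divn_small.
  by rewrite kj modn_small.
rewrite IH !mxE; congr (A _ _ * B _ _); apply/val_inj => /=.
  have m0 : (0 < m)%N by case: (m) j {kj} => // j; case: j => j; rewrite muln0.
  by rewrite kj divnDl // divnn m0.
by rewrite kj modnDl.
Qed.

Lemma tprod_entry n1 n m (B : 'M[R]_(n1, n)) (A : 'M[R]_m) k l :
  (B *t A) k l =
  B (kron_row k) (kron_row l) * A (kron_col k) (kron_col l).
Proof.
elim: n1 B k => [|n1 IH] B k; first by case: k.
rewrite /= mxE; case: splitP => j /= kj.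
  rewrite trow_entry !mxE; congr (B _ _ * A _ _); apply/val_inj => /=.
    by rewrite kj divn_small.
  by rewrite kj modn_small.
rewrite IH !mxE; congr (B _ _ * A _ _); apply/val_inj => /=.
  have m0 : (0 < m)%N by case: (m) j {kj} => // j; case: j => j; rewrite muln0.
  by rewrite kj divnDl // divnn m0.
by rewrite kj modnDl.
Qed.

Lemma tprod_tr n m (B : 'M[R]_n) (A : 'M[R]_m) : (B *t A)^T = B^T *t A^T.
Proof. by apply/matrixP => k l; rewrite mxE !tprod_entry !mxE. Qed.

Lemma tprodDl n m (B B' : 'M[R]_n) (A : 'M[R]_m) :
  (B + B') *t A = B *t A + B' *t A.
Proof. by apply/matrixP => k l; rewrite !(mxE, tprod_entry) mulrDl. Qed.

Lemma tprodDr n m (B : 'M[R]_n) (A A' : 'M[R]_m) :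
  B *t (A + A') = B *t A + B *t A'.
Proof. by apply/matrixP => k l; rewrite !(mxE, tprod_entry) mulrDr. Qed.

Lemma tprodZl n m a (B : 'M[R]_n) (A : 'M[R]_m) : (a *: B) *t A = a *: (B *t A).
Proof. by apply/matrixP => k l; rewrite !(mxE, tprod_entry) mulrA. Qed.

Lemma tprodZr n m a (B : 'M[R]_n) (A : 'M[R]_m) : B *t (a *: A) = a *: (B *t A).
Proof. by apply/matrixP => k l; rewrite !(mxE, tprod_entry) mulrCA. Qed.

Definition kron_vec n m (f : R -> R -> R) (y : 'rV[R]_n) (x : 'rV[R]_m) :
  'rV[R]_(n * m) := \row_k f (y 0 (kron_row k)) (x 0 (kron_col k)).

Lemma tprod_diag n m (y : 'rV[R]_n) (x : 'rV[R]_m) :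
  diag_mx y *t diag_mx x = diag_mx (kron_vec *%R y x).
Proof.
apply/matrixP => k l; rewrite tprod_entry !mxE.
have [->|kl] := eqVneq k l; first by rewrite !eqxx !mulr1n.
have [e|] := eqVneq (kron_row k) (kron_row l); last by rewrite mulr0n mul0r.
have [e'|] := eqVneq (kron_col k) (kron_col l); last by rewrite mulr0n mulr0.
by rewrite (kron_idx_inj e e') eqxx in kl.
Qed.

Lemma tprod_cdiag n m (Y : 'M[R]_n) (X : 'M[R]_m) y x :
  cdiag Y y *t cdiag X x = cdiag (Y *t X) (kron_vec *%R y x).
Proof. by rewrite /cdiag !character.tprodE tprod_diag tprod_tr. Qed.

Lemma tprod_orthmx n m (Y : 'M[R]_n) (X : 'M[R]_m) :
  orthmx Y -> orthmx X -> orthmx (Y *t X).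
Proof.
rewrite /orthmx => hY hX.
by rewrite tprod_tr -character.tprodE hY hX character.tprod1.
Qed.

Lemma tprod_cdiag_exp n m (Y : 'M[R]_n) (X : 'M[R]_m) y x :
  cdiag Y (expv y) *t cdiag X (expv x) =
  cdiag (Y *t X) (expv (kron_vec +%R y x)).
Proof.
rewrite tprod_cdiag; congr cdiag; apply/rowP => k.
by rewrite !mxE expRD.
Qed.

Lemma log_kron_cdiag n m (Y : 'M[R]_n) (X : 'M[R]_m) y x :
  orthmx Y -> orthmx X ->
  1%:M *t cdiag X x + cdiag Y y *t 1%:M = cdiag (Y *t X) (kron_vec +%R y x).
Proof.
move=> Yo Xo; rewrite -(orthmxC Xo) -(orthmxC Yo) -!cdiag_expv0 !tprod_cdiag.
rewrite -cdiagD.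
by congr cdiag; apply/rowP => k; rewrite !mxE expR0 mul1r mulr1 addrC.
Qed.

Lemma kron_family_spd n m (G : 'M[R]_(n * m)) : kron_family G -> spd G.
Proof.
case=> A [B [/spdP[U [a [Uo ->]]] /spdP[V [b [Vo ->]]] ->]].
rewrite tprod_cdiag_exp; apply: spd_expv; apply: orthmx_unit.
exact: tprod_orthmx.
Qed.

Lemma kron_family_log n m (G : 'M[R]_(n * m)) :
  kron_family G -> log_kron (logmx G).
Proof.
case=> A [B [/spdP[U [a [Uo ->]]] /spdP[V [b [Vo ->]]] ->]].
rewrite tprod_cdiag_exp logmx_cdiag; last exact: tprod_orthmx.
exists (cdiag U a), (cdiag V b); split; try exact/symmxP/cdiag_tr.
by rewrite log_kron_cdiag.
Qed.

(** A single frame [W] serves all [t]: the curve [exp (t Z)] stays in the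
    Kronecker family. *)
Lemma log_kron_cdiagP n m (Z : 'M[R]_(n * m)) : log_kron Z ->
  exists W z, [/\ orthmx W, Z = cdiag W z &
    forall t, kron_family (cdiag W (expv (t *: z)))].
Proof.
case=> X [Y [/symmxP/sym_spectral[U [a [Uo ->]]]]].
move=> /symmxP/sym_spectral[V [b [Vo ->]]] ->.
exists (V *t U), (kron_vec +%R b a); split.
- exact: tprod_orthmx.
- by rewrite log_kron_cdiag.
- move=> t; exists (cdiag U (expv (t *: a))), (cdiag V (expv (t *: b))).
  split; try by apply/spd_expv/orthmx_unit.
  rewrite tprod_cdiag_exp; congr (cdiag _ (expv _)).
  by apply/rowP => k; rewrite !mxE mulrDr.
Qed.

Lemma kron_family_congr n m (Y : 'M[R]_n) (X : 'M[R]_m) (G : 'M[R]_(n * m)) :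
  Y \in unitmx -> X \in unitmx -> kron_family G ->
  kron_family ((Y *t X)^T *m G *m (Y *t X)).
Proof.
move=> Yu Xu [A [B [Ap Bp ->]]].
exists (X^T *m A *m X), (Y^T *m B *m Y); split; try exact: spd_congr.
by rewrite !character.tprodE tprod_tr.
Qed.

Lemma tprod_spd n m (B : 'M[R]_n) (A : 'M[R]_m) :
  spd B -> spd A -> spd (B *t A).
Proof. by move=> Bp Ap; apply: kron_family_spd; exists A, B. Qed.

Lemma isqrt_tprod n m (B : 'M[R]_n) (A : 'M[R]_m) : spd B -> spd A ->
  powmx (B *t A) (- 2^-1) = powmx B (- 2^-1) *t powmx A (- 2^-1).
Proof.
move=> Bp Ap; apply: isqrt_uniq; first by apply: tprod_spd; exact: isqrt_spd.
by rewrite -!character.tprodE !isqrtK // character.tprod1.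
Qed.

(** Together with the next lemma: moving a base point [G] of the family to the
    identity by congruence maps the Kronecker family onto itself. *)
Lemma kron_family_isqrt n m (G Q : 'M[R]_(n * m)) :
  kron_family G -> kron_family Q ->
  kron_family (powmx G (- 2^-1) *m Q *m powmx G (- 2^-1)).
Proof.
move=> [A [B [Ap Bp ->]]] Qk; have Ya := isqrt_spd Ap; have Yb := isqrt_spd Bp.
have := kron_family_congr (spd_unit Yb) (spd_unit Ya) Qk.
by rewrite tprod_tr !spd_sym // isqrt_tprod.
Qed.

Lemma kron_family_isqrt_onto n m (G Q : 'M[R]_(n * m)) (Y := powmx G (- 2^-1)) :
  kron_family G -> kron_family Q ->
  exists2 P, kron_family P & Y *m P *m Y = Q.
Proof.
move=> Gk Qk.
have Yu : Y \in unitmx by exact/spd_unit/isqrt_spd/kron_family_spd.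
exists (invmx Y *m Q *m invmx Y); last first.
  by rewrite !mulmxA mulmxV // mul1mx mulmxKV.
case: Gk @Y Yu => A [B [Ap Bp ->]] Y Yu.
have Ya := isqrt_spd Ap; have Yb := isqrt_spd Bp.
have iY : invmx Y = invmx (powmx B (- 2^-1)) *t invmx (powmx A (- 2^-1)).
  rewrite -[RHS](mulKmx Yu) -[LHS]mulmx1; congr (_ *m _).
  rewrite /Y isqrt_tprod // -character.tprodE !mulmxV ?spd_unit //.
  by rewrite character.tprod1.
have := @kron_family_congr _ _ (invmx (powmx B (- 2^-1)))
  (invmx (powmx A (- 2^-1))) Q.
rewrite -iY !unitmx_inv !spd_unit // => /(_ isT isT Qk).
by rewrite iY tprod_tr !trmx_inv !spd_sym.
Qed.

Lemma kron_family_ai_log n m (G Q : 'M[R]_(n * m)) :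
  kron_family G -> kron_family Q -> log_kron (ai_log G Q).
Proof. by move=> Gk Qk; apply/kron_family_log/kron_family_isqrt. Qed.

End Kron.

(** * The projection onto the log-Kronecker subspace *)

Section Projection.
Context {R : realType}.

Lemma frob_riesz d (phi : 'M[R]_d -> R) :
  {morph phi : X Y / X + Y} -> (forall a X, phi (a *: X) = a * phi X) ->
  exists T, forall X, phi X = frob_dot T X.
Proof.
move=> phiD phiZ; exists (\matrix_(i, j) phi (delta_mx i j)) => X.
have phi0 : phi 0 = 0 by rewrite -[X in phi X](scale0r 0) phiZ mul0r.
rewrite {1}[X]matrix_sum_delta (big_morph phi phiD phi0) frob_dotE.
apply: eq_bigr => i _; rewrite (big_morph phi phiD phi0).
by apply: eq_bigr => j _; rewrite phiZ mxE mulrC.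
Qed.

Lemma frob_dot_tr d (S T : 'M[R]_d) : frob_dot S^T T = frob_dot S T^T.
Proof. by rewrite /frob_dot -mxtrace_tr trmx_mul trmxK mxtrace_mulC. Qed.

Lemma frob_dot_inj d (S T : 'M[R]_d) :
  (forall X, frob_dot S X = frob_dot T X) -> S = T.
Proof.
move=> h; apply/eqP; rewrite -subr_eq0; apply/eqP/frob_dot_eq0.
by rewrite frob_dotBl h subrr.
Qed.

Lemma frob_dot_tprod n m (B B' : 'M[R]_n) (A A' : 'M[R]_m) :
  frob_dot (B *t A) (B' *t A') = frob_dot B B' * frob_dot A A'.
Proof.
by rewrite /frob_dot tprod_tr -character.tprodE character.mxtrace_prod.
Qed.

Lemma frob_dot11 d : frob_dot (1%:M : 'M[R]_d) 1%:M = d%:R.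
Proof. by rewrite /frob_dot trmx1 mulmx1 mxtrace1. Qed.

(** Existence is explicit.  Let the partial traces [T1] and [T2] represent the
    functionals [X |-> <S, I t X>] and [Y |-> <S, Y t I>].  The orthogonality
    conditions read [n X + (tr Y) I = T1] and [(tr X) I + m Y = T2], and are
    solved with [tr Y = 0]. *)
Lemma log_kron_projE n m (S : 'M[R]_(n * m)) :
  (0 < m)%N -> (0 < n)%N -> S^T = S ->
  log_kron (log_kron_proj S) /\
  forall Z, log_kron Z -> frob_dot (log_kron_proj S) Z = frob_dot S Z.
Proof.
move=> m0 n0 ST.
have nz : n%:R != 0 :> R by rewrite pnatr_eq0 -lt0n.
have mz : m%:R != 0 :> R by rewrite pnatr_eq0 -lt0n.
have [T1 hT1] : exists T, forall X, frob_dot S (1%:M *t X) = frob_dot T X.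
  by apply: frob_riesz => [X X'|a X]; rewrite ?tprodDr ?tprodZr
     ?frob_dotDr ?frob_dotZr.
have [T2 hT2] : exists T, forall Y, frob_dot S (Y *t 1%:M) = frob_dot T Y.
  by apply: frob_riesz => [X X'|a X]; rewrite ?tprodDl ?tprodZl
     ?frob_dotDr ?frob_dotZr.
have T1T : T1^T = T1.
  apply: frob_dot_inj => X; rewrite frob_dot_tr -!hT1 -[in RHS]ST frob_dot_tr.
  by rewrite tprod_tr trmx1.
have T2T : T2^T = T2.
  apply: frob_dot_inj => X; rewrite frob_dot_tr -!hT2 -[in RHS]ST frob_dot_tr.
  by rewrite tprod_tr trmx1.
pose X := n%:R^-1 *: T1; pose c := frob_dot X 1%:M.
pose Y := m%:R^-1 *: (T2 - c *: 1%:M).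
pose W := 1%:M *t X + Y *t 1%:M.
have Y1 : frob_dot Y 1%:M = 0.
  rewrite frob_dotZl frob_dotBl frob_dotZl frob_dot11 /c frob_dotZl -hT1 -hT2.
  by rewrite mulrAC mulVf // mul1r subrr mulr0.
have WL : log_kron W.
  exists X, Y; split=> //; apply/symmxP; first by rewrite linearZ /= T1T.
  by rewrite linearZ linearB /= linearZ /= T2T trmx1.
have WP Z : log_kron Z -> frob_dot (S - W) Z = 0.
  move=> [X' [Y' [_ _ ->]]]; rewrite frob_dotBl !frob_dotDr hT1 hT2 /W.
  rewrite !frob_dotDl !frob_dot_tprod Y1 !frob_dot11 -/c.
  rewrite !frob_dotZl frob_dotBl frob_dotZl mulVKf // [_ * m%:R]mulrC mulVKf //.
  by ring.
rewrite /log_kron_proj; case: xgetP => [V _ [VL VP]|/(_ W)]; last by case.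
by split=> // Z ZL; have /eqP := VP Z ZL; rewrite frob_dotBl subr_eq0 => /eqP.
Qed.

Lemma ai_log_sym d (G M : 'M[R]_d) :
  spd G -> spd M -> (ai_log G M)^T = ai_log G M.
Proof.
move=> Gp Mp; have [U [l [Uo e]]] := spdP (isqrt_congr Gp Mp).
by rewrite /ai_log e logmx_cdiag // cdiag_tr.
Qed.

End Projection.

(** * Continuity of the distance *)

Section Continuity.
Context {R : realType}.
Local Open Scope classical_set_scope.

(** Continuity is only ever used entrywise, which reduces it to scalar sums and
    products. *)
Definition mx_cont_at (T : topologicalType) d e (x : T)
    (F : T -> 'M[R]_(d, e)) :=
  forall i j, {for x, continuous (fun t => F t i j)}.

Lemma mx_cont_cst (T : topologicalType) d e (x : T) (A : 'M[R]_(d, e)) :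
  mx_cont_at x (fun=> A).
Proof. by move=> i j; exact: cst_continuous. Qed.

Lemma continuous_at_sum (T : topologicalType) (I : Type) (r : seq I)
    (f : I -> T -> R) (x : T) :
  (forall i, {for x, continuous (f i)}) ->
  {for x, continuous (fun t => \sum_(i <- r) f i t)}.
Proof.
move=> h; elim: r => [|i r IH].
  have -> : (fun t => \sum_(i <- [::]) f i t) = (fun=> 0).
    by apply/funext => t; rewrite big_nil.
  exact: cst_continuous.
have -> : (fun t => \sum_(i <- i :: r) f i t) =
    (fun t => f i t + \sum_(i <- r) f i t).
  by apply/funext => t; rewrite big_cons.
by apply: (@continuousD _ R^o); [exact: h|exact: IH].
Qed.

Lemma mx_cont_mul (T : topologicalType) d e f (x : T)
    (F : T -> 'M[R]_(d, e)) (G : T -> 'M[R]_(e, f)) :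
  mx_cont_at x F -> mx_cont_at x G -> mx_cont_at x (fun t => F t *m G t).
Proof.
move=> hF hG i j.
have -> : (fun t => (F t *m G t) i j) = (fun t => \sum_k F t i k * G t k j).
  by apply/funext => t; rewrite mxE.
by apply: continuous_at_sum => k; apply: continuousM.
Qed.

Lemma ai_dist_cont (T : topologicalType) d (x : T) (F : T -> 'M[R]_d) :
  mx_cont_at x F -> spd (F x) -> forall e, 0 < e ->
  \forall t \near x, spd (F t) -> ai_dist (F x) (F t) <= e.
Proof.
move=> hF Fp e e0; set Y := powmx (F x) (- 2^-1).
pose C t := Y *m F t *m Y - 1%:M.
pose N t := frob_dot (C t) (C t).
have NC : {for x, continuous N}.
  have -> : N = (fun t => \sum_i \sum_j C t i j * C t i j).
    by apply/funext => t; rewrite /N frob_dotE.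
  apply: continuous_at_sum => i; apply: continuous_at_sum => j.
  have Cc : {for x, continuous (fun t => C t i j)}.
    have -> : (fun t => C t i j) =
        (fun t => (Y *m F t *m Y) i j + (- (1%:M : 'M[R]_d) i j)).
      by apply/funext => t; rewrite mxE [X in _ + X]mxE.
    apply: (@continuousD _ R^o); last exact: cst_continuous.
    by apply: mx_cont_mul; [apply: mx_cont_mul => //|]; exact: mx_cont_cst.
  exact: continuousM.
have N0 : N x = 0.
  by rewrite /N /C isqrtK // subrr /frob_dot mulmx0 mxtrace0.
(* The bound 1/2 is the validity range of [ai_dist_near]. *)
pose r := Num.min (e / 2) 2^-1.
have r0 : 0 < r by rewrite lt_min divr_gt0 //= invr_gt0.
have : \forall t \near x, N t < r ^+ 2.
  move/cvgrPdist_lt : NC => /(_ (r ^+ 2) (exprn_gt0 _ r0)); apply: filterS => t.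
  by rewrite N0 sub0r normrN ger0_norm // /N frob_dot_ge0.
apply: filterS => t Nt Ftp.
have Cr : frob_norm (C t) <= r.
  rewrite -(@ler_pXn2r _ 2) ?nnegrE ?frob_norm_ge0 ?(ltW r0) //.
  by rewrite frob_normE ltW.
apply: le_trans (ai_dist_near Fp Ftp _) _.
  by apply: le_trans Cr _; rewrite ge_min lexx orbT.
rewrite mulrC -ler_pdivlMr //; apply: le_trans Cr _.
by rewrite ge_min lexx.
Qed.

End Continuity.

(** * The first-order condition at a minimizer *)

Section FirstOrder.
Context {R : realType}.
Local Open Scope classical_set_scope.

(** First-order condition.  After a congruence, [P] is the identity and [M] is
    [M'].  Let [V] be the residual, [E_t = exp (t V)], and [S_t] the logarithm
    of [M'] seen from [E_t].  The law of cosines at [E_t] for [I] and [M'],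
    together with minimality at [I], gives [<V, S_t> <= 0].  As [t] tends to
    [0], [S_t] tends to [S = log M'], since the logarithm is Lipschitz for the
    distance; hence [|V|^2 = <V, S> <= 0]. *)
Lemma kron_minimizer_residual n m (M P : 'M[R]_(n * m)) :
  (0 < m)%N -> (0 < n)%N -> spd M -> kron_family P ->
  (forall G, kron_family G -> ai_dist M P <= ai_dist M G) ->
  kron_residual M P = 0.
Proof.
move=> m0 n0 Mp Pk Pmin; have Pp := kron_family_spd Pk.
have [VL VS] := log_kron_projE m0 n0 (ai_log_sym Pp Mp).
set S := ai_log P M in VS; rewrite /kron_residual -/S.
rewrite -/S in VL; set V := log_kron_proj S in VL VS *.
have [W [z [Wo Vz Wk]]] := log_kron_cdiagP VL.
pose Y := powmx P (- 2^-1); pose M' := Y *m M *m Y.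
have M'p : spd M' by exact: isqrt_congr.
have one_min t : ai_dist 1%:M M' <= ai_dist (cdiag W (expv (t *: z))) M'.
  have [Q Qk QE] := kron_family_isqrt_onto Pk (Wk t).
  rewrite -QE !(ai_distC _ M'p); last 2 first.
  - by rewrite QE; exact/kron_family_spd.
  - exact: spd1.
  rewrite -(isqrtK Pp) !ai_dist_isqrt //; first exact: Pmin.
  exact: kron_family_spd.
pose F t := cdiag W (expv ((- (t / 2)) *: z)).
pose N t := F t *m M' *m F t.
have F0 : F 0 = 1%:M.
  by rewrite /F mul0r oppr0 scale0r cdiag_expv0 orthmxC.
have Fp t : spd (F t) by exact/spd_expv/orthmx_unit.
have Np t : spd (N t).
  by have := spd_congr (spd_unit (Fp t)) M'p; rewrite (spd_sym (Fp t)).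
have bound t : 0 < t -> frob_norm V <= ai_dist M' (N t).
  move=> t0; set E := cdiag W (expv (t *: z)).
  have Ep : spd E by exact/spd_expv/orthmx_unit.
  have EF : powmx E (- 2^-1) = F t.
    by rewrite /E (powmx_cdiag _ _ Wo) scalerA mulNr mulrC.
  have := ai_dist_cosine Ep (spd1 _) M'p.
  have -> : ai_log E 1%:M = - t *: V.
    rewrite /ai_log EF mulmx1 /F (cdiag_expvD _ _ Wo) (logmx_cdiag _ Wo).
    by rewrite -scalerDl -opprD -splitr cdiagZ -Vz.
  have -> : ai_log E M' = logmx (N t) by rewrite /ai_log EF.
  rewrite frob_dotZl => h.
  have h2 : ai_dist 1%:M M' ^+ 2 <= ai_dist E M' ^+ 2.
    by rewrite lerXn2r ?nnegrE ?ai_dist_ge0 // one_min.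
  have h3 : frob_dot V (logmx (N t)) <= 0.
    rewrite -(pmulr_rle0 _ t0).
    have := sqr_ge0 (ai_dist E 1%:M); lra.
  have h4 : frob_norm V ^+ 2 <= frob_norm V * ai_dist M' (N t).
    rewrite frob_normE VS // frob_dotC.
    have -> : S = logmx (N t) + (S - logmx (N t)) by rewrite addrC subrK.
    rewrite frob_dotDr -[leRHS]add0r lerD //.
    apply: le_trans (frob_CS _ _) _; rewrite ler_wpM2l ?frob_norm_ge0 //.
    exact: ai_dist_log.
  have [->|V0] := eqVneq (frob_norm V) 0; first exact: ai_dist_ge0.
  by move: h4; rewrite expr2 ler_pM2l // lt0r V0 frob_norm_ge0.
have NC : mx_cont_at 0 N.
  have FC : mx_cont_at 0 F.
    apply: mx_cont_mul; last exact: mx_cont_cst.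
    apply: mx_cont_mul; first exact: mx_cont_cst.
    move=> i j.
    have -> : (fun t => diag_mx (expv ((- (t / 2)) *: z)) i j) =
        (fun t => expR (t * - (z 0 i / 2)) * (i == j)%:R).
      apply/funext => t; rewrite !mxE mulr_natr; congr (expR _ *+ _).
      by field.
    apply: continuousM; last exact: cst_continuous.
    apply: continuous_comp; last exact: continuous_expR.
    by apply: continuousM => //; exact: cst_continuous.
  by apply: mx_cont_mul => //; apply: mx_cont_mul => //; exact: mx_cont_cst.
apply: frob_norm_eq0; apply/eqP; rewrite eq_le frob_norm_ge0 andbT.
apply/ler_addgt0Pl => e e0; rewrite addr0.
have N0 : N 0 = M' by rewrite /N F0 mul1mx mulmx1.
have := ai_dist_cont NC; rewrite N0 => /(_ M'p e e0).
move=> near0.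
have h : \forall t \near (0:R)^'+,
    0 < t /\ (spd (N t) -> ai_dist M' (N t) <= e).
  by near=> t; split; near: t; [exact: nbhs_right_gt|exact: cvg_within near0].
have [t [t0 /(_ (Np t))]] := filter_ex h.
by apply: le_trans; exact: bound.
Unshelve. all: end_near. Qed.
End FirstOrder.

(** * Existence of a minimizer *)

Section Existence.
Context {R : realType}.
Local Open Scope classical_set_scope.

Lemma closed_cont_ge0 (T : topologicalType) (f : T -> R) :
  continuous f -> closed [set x | 0 <= f x].
Proof.
move=> fc; have -> : [set x | 0 <= f x] = f @^-1` [set y | 0 <= y] by [].
by apply: closed_comp => [x _|]; [exact: fc|exact: closed_ge].
Qed.

(** The bounds make this set compact, and [a > 0] keeps its limit points inside
    the positive definite cone. *)
Definition spd_box d (a r : R) : set 'M[R]_d :=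
  [set A : 'M[R]_d | [/\ forall i j, `|A i j| <= r, A^T = A &
    forall v : 'cV[R]_d, a * (v^T *m v) 0 0 <= (v^T *m A *m v) 0 0]].

Lemma spd_box_spd d (a r : R) (A : 'M[R]_d) : 0 < a -> spd_box a r A -> spd A.
Proof.
move=> a0 [_ AT Aa]; split; first exact/symmxP.
move=> v v0; apply: lt_le_trans (Aa v); rewrite mulr_gt0 // lt0r.
have := row_dot_ge0 v^T; rewrite trmxK => ->; rewrite andbT.
apply: contraNneq v0 => h; apply/eqP.
rewrite -[v]trmxK (row_dot_eq0 (v := v^T)) ?trmx0 //.
by rewrite trmxK.
Qed.

Lemma spd_box_cdiag d (U : 'M[R]_d) (x : 'rV[R]_d) (c : R) : orthmx U ->
  (forall i, `|x 0 i| <= c) ->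
  spd_box (expR (- c)) (d%:R * expR c) (cdiag U (expv x)).
Proof.
move=> Uo xc; split; last 1 first.
- move=> v; rewrite cdiag_form.
  have -> : v^T *m v = v^T *m cdiag U (expv 0) *m v.
    by rewrite cdiag_expv0 (orthmxC Uo) mulmx1.
  rewrite cdiag_form mulr_sumr; apply: ler_sum => i _; rewrite mulrA.
  rewrite ler_wpM2r ?sqr_ge0 // !mxE expR0 mulr1 ler_expR.
  by have := xc i; rewrite ler_norml => /andP[].
- move=> i j; apply: le_trans (frob_entry _ _ _) _.
  rewrite -(@ler_pXn2r _ 2) ?nnegrE ?frob_norm_ge0 ?mulr_ge0 ?expR_ge0 //.
  rewrite frob_norm_cdiag //.
  apply: (@le_trans _ _ (\sum_(k < d) expR c ^+ 2)).
    apply: ler_sum => k _; rewrite mxE lerXn2r ?nnegrE ?expR_ge0 // ler_expR.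
    exact: le_trans (ler_norm _) (xc k).
  rewrite sumr_const card_ord -[leLHS]mulr_natl [leRHS]exprMn.
  rewrite ler_wpM2r ?sqr_ge0 //.
  rewrite -natrX ler_nat; case: (d) => // d'.
  by rewrite expnS expn1 leq_pmulr.
- exact: cdiag_tr.
Qed.

Lemma spd_box_compact d (a r : R) :
  compact [set x : 'rV[R]_(d * d) | spd_box a r (vec_mx x)].
Proof.
have ec (i j : 'I_d) : continuous (fun x : 'rV[R]_(d * d) => vec_mx x i j).
  move=> x; have -> : (fun x : 'rV[R]_(d * d) => vec_mx x i j) =
      (fun x => x 0 (mxvec_index i j)) by apply/funext => y; rewrite mxE.
  exact: coord_continuous.
have -> : [set x : 'rV[R]_(d * d) | spd_box a r (vec_mx x)] =
  [set x : 'rV[R]_(d * d) | forall k, `[- r, r] (x 0 k)] `&`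
  ((\bigcap_(i in [set: 'I_d]) \bigcap_(j in [set: 'I_d])
      [set x | 0 <= vec_mx x i j - vec_mx x j i]) `&`
   \bigcap_(v in [set: 'cV[R]_d])
     [set x | 0 <= (v^T *m vec_mx x *m v) 0 0 - a * (v^T *m v) 0 0]).
  apply/seteqP; split => [x [xr xT xa]|x /= [xr [xT xa]]].
    split=> /=; last split.
    - move=> k; rewrite in_itv /= -ler_norml.
      by case/mxvec_indexP: k => i j; have := xr i j; rewrite mxE.
    - by move=> i _ j _ /=; rewrite -{1}xT mxE subrr.
    - by move=> v _ /=; rewrite subr_ge0.
  split.
  - move=> i j; rewrite mxE ler_norml.
    by have := xr (mxvec_index i j); rewrite in_itv.
  - apply/matrixP => i j; rewrite [LHS]mxE; apply/eqP.
    have h1 : 0 <= vec_mx x i j - vec_mx x j i := xT i I j I.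
    have h2 : 0 <= vec_mx x j i - vec_mx x i j := xT j I i I.
    by rewrite eq_le -subr_ge0 h1 -subr_ge0 h2.
  - by move=> v; have := xa v I; rewrite /= subr_ge0.
apply: compact_closedI.
  apply: (@rV_compact _ _ (fun=> `[- r, r]%classic)) => _.
  exact: segment_compact.
apply: closedI.
  apply: closed_bigI => i _; apply: closed_bigI => j _.
  by apply: closed_cont_ge0 => x; apply: (@continuousB _ R^o); exact: ec.
apply: closed_bigI => v _; apply: closed_cont_ge0 => x.
apply: (@continuousB _ R^o _ (fun x => (v^T *m vec_mx x *m v) 0 0)
  (fun=> a * (v^T *m v) 0 0)); last exact: cst_continuous.
apply: mx_cont_mul; last exact: mx_cont_cst.
by apply: mx_cont_mul; [exact: mx_cont_cst|move=> i j; exact: ec].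
Qed.

Lemma ai_dist1 d (U : 'M[R]_d) l : orthmx U ->
  ai_dist 1%:M (cdiag U (expv l)) ^+ 2 = \sum_i l 0 i ^+ 2.
Proof.
by move=> Uo; have := ai_dist_pencil l (orthmx_unit Uo); rewrite orthmxC.
Qed.

(** The factors of [B t A] are determined up to a scalar.  Normalizing one
    eigenvalue of [B] to 1 bounds the logarithms of all eigenvalues of [A] by
    [r] and of [B] by [2 r], because their pairwise sums are bounded by [r]. *)
Lemma kron_family_box n m (G : 'M[R]_(n * m)) (r : R) :
  (0 < m)%N -> (0 < n)%N -> kron_family G -> ai_dist 1%:M G <= r ->
  exists A B, [/\ spd_box (expR (- (r *+ 2))) (m%:R * expR (r *+ 2)) A,
    spd_box (expR (- (r *+ 2))) (n%:R * expR (r *+ 2)) B & G = B *t A].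
Proof.
move=> m0 n0 [A [B [/spdP[U [x [Uo ->]]] /spdP[V [y [Vo ->]]] ->]]].
rewrite tprod_cdiag_exp => Gr.
have VU := tprod_orthmx Vo Uo.
have xy i j : `|y 0 i + x 0 j| <= r.
  apply: le_trans Gr; rewrite -(@ler_pXn2r _ 2) ?nnegrE ?ai_dist_ge0 //.
  rewrite (ai_dist1 _ VU) -normrX ger0_norm ?sqr_ge0 //.
  have [k <- <-] := kron_idx_surj i j.
  rewrite (bigD1 k) //= mxE lerDl sumr_ge0 // => l _; exact: sqr_ge0.
have r0 : 0 <= r := le_trans (ai_dist_ge0 _ _) Gr.
pose i0 := Ordinal n0; pose j0 := Ordinal m0; pose s := y 0 i0.
exists (cdiag U (expv (x + const_mx s))), (cdiag V (expv (y - const_mx s))).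
split.
- apply: spd_box_cdiag => // j; rewrite !mxE addrC.
  by apply: le_trans (xy i0 j) _; rewrite mulr2n lerDl.
- apply: spd_box_cdiag => // i; rewrite !mxE.
  have -> : y 0 i - s = (y 0 i + x 0 j0) - (s + x 0 j0) by ring.
  by apply: le_trans (ler_normB _ _) _; rewrite mulr2n lerD ?xy //; exact: xy.
- rewrite tprod_cdiag_exp; congr (cdiag _ (expv _)); apply/rowP => k.
  by rewrite !mxE; ring.
Qed.

Lemma kron_family1 n m : kron_family (1%:M : 'M[R]_(n * m)).
Proof.
by exists 1%:M, 1%:M; split; [exact: spd1|exact: spd1|rewrite character.tprod1].
Qed.

(** A competitor at least as good as the identity lies within [2 d(I, M)] of the
    identity, by the triangle inequality; such competitors are the images of a
    compact set of pairs [(A, B)]. *)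
Lemma kron_minimizer n m (M : 'M[R]_(n * m)) :
  (0 < m)%N -> (0 < n)%N -> spd M ->
  exists2 P, kron_family P &
    forall G, kron_family G -> ai_dist M P <= ai_dist M G.
Proof.
move=> m0 n0 Mp; have p1 : spd (1%:M : 'M[R]_(n * m)) := spd1 _.
pose r := ai_dist 1%:M M *+ 2.
pose a := expR (- (r *+ 2)); have a0 : 0 < a by exact: expR_gt0.
pose C k := [set x : 'rV[R]_(k * k) |
  spd_box a (k%:R * expR (r *+ 2)) (vec_mx x)].
pose F (p : 'rV[R]_(m * m) * 'rV[R]_(n * n)) : 'M[R]_(n * m) :=
  vec_mx p.2 *t vec_mx p.1.
have Fk p : (C m `*` C n) p -> kron_family (F p).
  move=> [pA pB]; exists (vec_mx p.1), (vec_mx p.2).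
  by split=> //; [exact: spd_box_spd pA|exact: spd_box_spd pB].
have cover G : kron_family G -> ai_dist 1%:M G <= r ->
    exists2 p, (C m `*` C n) p & F p = G.
  move=> Gk /(kron_family_box m0 n0 Gk)[A [B [hA hB ->]]].
  by exists (mxvec A, mxvec B); rewrite /F /C /= ?mxvecK.
have [p1C p1C' Fp1] : exists2 p, (C m `*` C n) p & F p = 1%:M.
  apply: cover; first exact: kron_family1.
  have -> : ai_dist (1%:M : 'M[R]_(n * m)) 1%:M = 0.
    apply/eqP; rewrite -sqrf_eq0; apply/eqP.
    have := ai_dist1 0 (orthmx1 (n * m)).
    rewrite cdiag_expv0 trmx1 mulmx1 => ->.
    by apply: big1 => i _; rewrite mxE expr0n.
  by rewrite mulrn_wge0 // ai_dist_ge0.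
have [|||p] := @compact_EVT_min _ R (fun p => ai_dist M (F p)) (C m `*` C n).
- by exists p1C.
- by apply: compact_setX; exact: spd_box_compact.
- apply/subspace_continuousP => x xC.
  apply/cvgrPdist_le => e e0.
  have Fc : mx_cont_at x F.
    move=> k l.
    have -> : (fun p => F p k l) = (fun p =>
        p.2 0 (mxvec_index (kron_row k) (kron_row l)) *
        p.1 0 (mxvec_index (kron_col k) (kron_col l))).
      by apply/funext => p; rewrite /F tprod_entry !mxE.
    apply: continuousM.
      apply: (@continuous_comp _ _ _ snd (fun y : 'rV[R]_(n * n) => y 0 _)).
        exact: cvg_snd.
      exact: coord_continuous.
    apply: (@continuous_comp _ _ _ fst (fun y : 'rV[R]_(m * m) => y 0 _)).
      exact: cvg_fst.
    exact: coord_continuous.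
  have Fxp := kron_family_spd (Fk _ xC).
  have := ai_dist_cont Fc Fxp e0.
  rewrite near_withinE; apply: filterS => t Ft tC.
  have Ftp := kron_family_spd (Fk _ tC); have {}Ft := Ft Ftp.
  have h1 := ai_dist_triangle Fxp Mp Ftp.
  have h2 := ai_dist_triangle Ftp Mp Fxp.
  rewrite (ai_distC Ftp Fxp) in h2.
  change (`|ai_dist M (F x) - ai_dist M (F t)| <= e).
  rewrite ler_norml; apply/andP; split; lra.
move=> /set_mem pC pmin; exists (F p); first exact: Fk.
have pmin' q : (C m `*` C n) q -> ai_dist M (F p) <= ai_dist M (F q).
  by move=> qC; apply: pmin; exact: mem_set.
move=> G Gk.
have [GM|/ltW GM] := leP (ai_dist M G) (ai_dist M 1%:M); last first.
  by apply: le_trans GM; rewrite -Fp1; exact: pmin'.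
have Gp := kron_family_spd Gk.
have [|q qC <-] := cover G Gk; last exact: pmin'.
apply: le_trans (ai_dist_triangle Mp p1 Gp) _.
by rewrite /r mulr2n lerD2l (ai_distC p1 Mp).
Qed.

End Existence.

(** * Residual bounds *)

Theorem corollary5p13 (R : realType) (m n : nat)
    (hm : (1 <= m)%N) (hn : (1 <= n)%N)
    (M : 'M[R]_(n * m)) (hM : spd M)
    (G : 'M[R]_(n * m)) (hG : kron_family G) :
  (kron_residual M G = 0 <-> G = kron_proj M)
  /\ ai_dist G (kron_proj M) <= frob_norm (kron_residual M G)
  /\ 0 <= ai_energy M G - ai_energy M (kron_proj M)
       <= 2^-1 * frob_norm (kron_residual M G) ^+ 2.
Proof.
have [Pk Pmin] : kron_family (kron_proj M) /\
    forall Q, kron_family Q -> ai_dist M (kron_proj M) <= ai_dist M Q.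
  rewrite /kron_proj; case: xgetP => [_ _ //|none].
  by have [Q Qk Qmin] := kron_minimizer hm hn hM; case: (none Q).
set P := kron_proj M in Pk Pmin *.
have VP : kron_residual M P = 0 by exact: kron_minimizer_residual.
have Pp := kron_family_spd Pk; have Gp := kron_family_spd hG.
have residualE Q Z : kron_family Q -> log_kron Z ->
    frob_dot (kron_residual M Q) Z = frob_dot (ai_log Q M) Z.
  move=> Qk; have Qp := kron_family_spd Qk.
  by have [_] := log_kron_projE hm hn (ai_log_sym Qp hM); apply.
set V := kron_residual M G.
(* At [P] the scalar product in the law of cosines vanishes; at [G] it is a
   scalar product with [V]. *)
have := ai_dist_cosine Gp Pp hM; have := ai_dist_cosine Pp Gp hM.
rewrite ![frob_dot (ai_log _ _) (ai_log _ M)]frob_dotC.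
rewrite -(residualE G) //; last exact: kron_family_ai_log.
rewrite -(residualE P) //; last exact: kron_family_ai_log.
rewrite VP (ai_distC Pp Gp).
rewrite /frob_dot trmx0 mul0mx mxtrace0 -/(frob_dot _ _) -/V.
have := frob_CS V (ai_log G P); rewrite -/(ai_dist G P).
have := Pmin G hG; rewrite !(ai_distC hM) //.
have := frob_norm_ge0 V; have := ai_dist_ge0 G P; have := ai_dist_ge0 P M.
rewrite /ai_energy; set u := frob_dot V _; set v := frob_norm V.
set p := ai_dist P M; set g := ai_dist G M; set D := ai_dist G P.
move=> p0 D0 v0 pg uv h1 h2.
have Dv : D <= v.
  have [->//|D1] := eqVneq D 0.
  by rewrite -(@ler_pM2l _ D) ?lt0r ?D1 //; nra.
split; last by split=> //; apply/andP; split; nra.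
split=> [V0|GP]; last by rewrite /V GP.
apply: ai_dist_eq0 => //; apply/eqP.
rewrite eq_le ai_dist_ge0 andbT; apply: le_trans Dv _.
by rewrite /v V0 frob_norm0.
Qed.
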